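(* Let $\alpha\in(0,2]$. Let $X_1,X_2,\ldots$ be independent identically distributed random variables with $\mathsf{E}X_1=0$ and $0<\sigma^2=\mathsf{Var}(X_1)<\infty$, and let $S^*_n=X_1+\ldots+X_n$ for $n\in\mathbb{N}$, with $S^*_0=0$. Let $Z_1,Z_2,\ldots$ be a sequence of integer-valued nonnegative random variables defined on the same probability space such that for each $n\ge1$ the random variable $Z_n$ is independent of the sequence $X_1,X_2,\ldots$. Assume moreover that $Z_n\to\infty$ in probability as $n\to\infty$, i.e. $\mathsf{P}(Z_n\le m)\to0$ as $n\to\infty$ for every $m\in(0,\infty)$. Then the normalized random sums $\frac{S^*_{Z_n}}{\sigma\sqrt n}$ converge in distribution, as $n\to\infty$, to the Linnik distribution with parameter $\alpha$ if and only if $$\frac{Z_n}{n}\Longrightarrow 2M_{\alpha/2}\qquad(n\to\infty),$$ where $M_{\alpha/2}$ is a random variable with the Mittag-Leffler distribution with parameter $\alpha/2$.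
   Context: The symbol $\Longrightarrow$ denotes convergence in distribution. Linnik distribution with parameter $\alpha\in(0,2]$: the probability distribution on $\mathbb{R}$ with characteristic function $t\mapsto \frac{1}{1+|t|^{\alpha}}$, $t\in\mathbb{R}$. Mittag-Leffler distribution with parameter $\delta\in(0,1]$: the distribution of a nonnegative random variable $M_\delta$ with Laplace transform $\mathsf{E}e^{-sM_\delta}=\frac{1}{1+s^{\delta}}$, $s\ge 0$. $S^*_{Z_n}$ denotes the random sum $X_1+\ldots+X_{Z_n}$ (equal to $0$ when $Z_n=0$). *)

(* Defs.v *)
From HB Require Import structures.
From mathcomp Require Import all_boot all_order all_algebra finmap.
From mathcomp Require Import complex.
From mathcomp Require Import all_classical all_reals all_analysis.

Set Implicit Arguments.
Unset Strict Implicit.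
Unset Printing Implicit Defensive.

Import Order.TTheory GRing.Theory Num.Theory.
Import numFieldNormedType.Exports.

Local Open Scope classical_set_scope.
Local Open Scope ring_scope.

Definition mutually_independent d (T : measurableType d) (R : realType)
    (P : probability T R) (I : choiceType) (F : I -> set (set T)) : Prop :=
  forall (J : {fset I}) (A : I -> set T),
    (forall i, i \in J -> F i (A i)) ->
    P (\bigcap_(i in [set` J]) A i) = (\prod_(i <- J) P (A i))%E.

Definition independent d (T : measurableType d) (R : realType)
    (P : probability T R) (F G : set (set T)) : Prop :=
  forall A B, F A -> G B -> P (A `&` B) = (P A * P B)%E.

Definition sigma_of_sequence d d' (T : measurableType d)
    (T' : measurableType d') (X : nat -> T -> T') : set (set T) :=
  <<s \bigcup_i g_sigma_algebra_preimage (X i) >>.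

Definition iid d (T : measurableType d) (R : realType) (P : probability T R)
    (X : nat -> {RV P >-> R}) : Prop :=
  mutually_independent P (fun i => g_sigma_algebra_preimage (X i)) /\
  forall i (B : set R), measurable B ->
    distribution P (X i) B = distribution P (X 0%N) B.

Definition cvg_in_distribution d (T : measurableType d) d'
    (T' : measurableType d') (R : realType) (P : probability T R)
    (P' : probability T' R) (Y : nat -> T -> R) (Y' : T' -> R) : Prop :=
  forall f : R -> R, continuous f -> bounded_fun f ->
    ('E_P[f \o Y n] @[n --> \oo] --> 'E_P'[f \o Y'])%E.

(* Real and imaginary parts of the integral of exp(i t x). *)
Definition characteristic_function (R : realType) (mu : probability R R)
    (t : R) : R[i] :=
  Complex (\int[mu]_x cos (t * x)) (\int[mu]_x sin (t * x)).

Definition linnik (R : realType) (alpha : R) (mu : probability R R) : Prop :=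
  forall t : R,
    characteristic_function mu t = Complex (1 / (1 + `|t| `^ alpha)) 0.

Definition mittag_leffler (R : realType) (delta : R) (mu : probability R R) :
    Prop :=
  mu [set x | 0 <= x] = 1%E /\
  forall s : R, 0 <= s ->
    ('E_mu[fun x => expR (- s * x)] = (1 / (1 + s `^ delta))%:E)%E.

(* The sequence X_1, X_2, ... is indexed from 0: X i stands for X_(i+1). *)
Definition partial_sum (T : Type) (R : realType) (X : nat -> T -> R) (n : nat)
    (w : T) : R := \sum_(i < n) X i w.

Definition random_sum (T : Type) (R : realType) (X : nat -> T -> R)
    (N : T -> nat) (w : T) : R := partial_sum X (N w) w.

(* Main.v *)
Require Import Defs.
From HB Require Import structures.
From mathcomp Require Import all_boot all_order all_algebra finmap.
From mathcomp Require Import complex ring lra.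
From mathcomp Require Import all_classical all_reals all_analysis.
From mathcomp Require Import measurable_realfun.
Import Order.TTheory GRing.Theory Num.Theory.
Import numFieldNormedType.Exports.

Set Implicit Arguments.
Unset Strict Implicit.
Unset Printing Implicit Defensive.

Local Open Scope classical_set_scope.
Local Open Scope ring_scope.

(** Let phi be the characteristic function of X_1, u = t / (sigma sqrt n) and
    q = exp(- t^2 / (2 n)). Since phi(u) = 1 - t^2 / (2 n) + o(1 / n), the powers
    phi(u)^k and q^k differ by o(1) uniformly in k, whence
    E exp(i t S_(Z_n) / (sigma sqrt n)) - E exp(- (t^2 / 2) Z_n / n) -> 0.
    The Linnik characteristic function at t is the Laplace transform of
    2 M_(alpha / 2) at t^2 / 2, so each of the two convergences amounts to the same
    convergence of transforms, by the continuity theorems for Laplace transforms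
    and for characteristic functions. Both continuity theorems are reduced to
    Weierstrass' theorem by squeezing the line into a compact interval, through
    exp(- x / A) and through the pair sin, cos of pi x / (2 A) respectively; the
    error is controlled by a test function whose expectation is small at the
    limit law, which replaces tightness. *)

(** * Taylor bounds *)

Section taylor.
Context {R : realType}.
Implicit Types (f : R -> R) (x y : R).

(** The difficulty is that nothing bounds Z_n / n a priori in the forward implication, so comparing
    phi(u)^k with q^k for k of order n would not suffice. The number q is chosen so that q^k is
    exactly exp(- (t^2 / 2) k / n). Each new factor adds an error of size |phi(u) - q|, and earlier
    errors are damped by powers of q, so the total is at most of order |phi(u) - q| / (1 - q). Since
    1 - q is of order 1 / n and |phi(u) - q| is o(1 / n), this vanishes whatever the law of Z_n.
    Only a second moment is available for the o(1 / n). Hence each Taylor remainder is bounded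
    twice: to a higher order for its pointwise limit, and quadratically for an integrable dominating
    function. The factor 2 and the index alpha / 2 come from (2 (t^2 / 2))^(alpha / 2) =
    |t|^alpha. *)

Lemma ge0_of_derive_ge0 f (f' : R -> R) :
  (forall x, is_derive x (1 : R) f (f' x)) -> f 0 = 0 ->
  (forall x, 0 <= x -> 0 <= f' x) -> forall x, 0 <= x -> 0 <= f x.
Proof.
move=> df f0 f'0 x x0; rewrite -f0.
have dr z : derivable f z 1 by have [] := df z.
apply: (@ger0_derive1_ndecr _ f 0 x) => //.
- move=> z; rewrite in_itv/= => /andP[/ltW z0 _].
  by rewrite derive1E (@derive_val _ _ _ _ _ _ _ (df z)) f'0.
- by apply: derivable_within_continuous => z _.
Qed.

(** Start of a chain of four bounds: the derivative of each difference is the difference treated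
    just before, beginning here with [1 - cos y]. *)
Lemma sin_le_id x : 0 <= x -> sin x <= x.
Proof.
move=> x0; rewrite -subr_ge0.
apply: (@ge0_of_derive_ge0 (fun y => y - sin y) (fun y => 1 - cos y)) x0 => //.
by rewrite sin0 subrr.
Qed.

Lemma one_sub_cos_le x : 0 <= x -> 1 - cos x <= x ^+ 2 / 2.
Proof.
move=> x0; rewrite -subr_ge0.
apply: (@ge0_of_derive_ge0 (fun y => y ^+ 2 / 2 - (1 - cos y))
  (fun y => y - sin y)) x0 => //.
- move=> y; apply: is_derive_eq.
  by rewrite /GRing.scale/=; field.
- by rewrite cos0; field.
- by move=> y y0; rewrite subr_ge0 sin_le_id.
Qed.

Lemma id_sub_sin_le x : 0 <= x -> x - sin x <= x ^+ 3 / 6.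
Proof.
move=> x0; rewrite -subr_ge0.
apply: (@ge0_of_derive_ge0 (fun y => y ^+ 3 / 6 - (y - sin y))
  (fun y => y ^+ 2 / 2 - (1 - cos y))) x0 => //.
- move=> y; apply: is_derive_eq.
  by rewrite /GRing.scale/=; field.
- by rewrite sin0; field.
- by move=> y y0; rewrite subr_ge0 one_sub_cos_le.
Qed.

Lemma cos_sub_le x : 0 <= x -> cos x - (1 - x ^+ 2 / 2) <= x ^+ 4 / 24.
Proof.
move=> x0; rewrite -subr_ge0.
apply: (@ge0_of_derive_ge0 (fun y => y ^+ 4 / 24 - (cos y - (1 - y ^+ 2 / 2)))
  (fun y => y ^+ 3 / 6 - (y - sin y))) x0 => //.
- move=> y; apply: is_derive_eq.
  by rewrite /GRing.scale/=; field.
- by rewrite cos0; field.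
- by move=> y y0; rewrite subr_ge0 id_sub_sin_le.
Qed.

Lemma norm_sin_le x : `|sin x| <= `|x|.
Proof.
have -> : `|sin x| = `|sin `|x| |.
  by case: (ger0P x) => // _; rewrite sinN normrN.
rewrite ler_norml sin_le_id// andbT.
rewrite -subr_ge0.
apply: (@ge0_of_derive_ge0 (fun y => sin y - - y) (fun y => cos y + 1)) => //.
- by move=> y; apply: is_derive_eq; rewrite opprK.
- by rewrite sin0; ring.
Qed.

Lemma cos_taylor_bound4 x : `|cos x - (1 - x ^+ 2 / 2)| <= x ^+ 4 / 24.
Proof.
have -> : x ^+ 4 = `|x| ^+ 4 by rewrite (exprM _ 2 2) (exprM _ 2 2) real_normK ?num_real.
have -> : x ^+ 2 = `|x| ^+ 2 by rewrite real_normK ?num_real.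
rewrite -cos_norm ger0_norm ?cos_sub_le//.
by have := one_sub_cos_le (normr_ge0 x); lra.
Qed.

Lemma cos_taylor_bound2 x : `|cos x - (1 - x ^+ 2 / 2)| <= x ^+ 2 / 2.
Proof.
have -> : x ^+ 2 = `|x| ^+ 2 by rewrite real_normK ?num_real.
rewrite -cos_norm ger0_norm ?cos_sub_le//.
  by have := cos_le1 `|x|; lra.
by have := one_sub_cos_le (normr_ge0 x); lra.
Qed.

Lemma sin_taylor_bound3 x : `|sin x - x| <= `|x| ^+ 3 / 6.
Proof.
wlog x0 : x / 0 <= x.
  move=> H; have [/H//|/ltW x0] := leP 0 x.
  have : 0 <= - x by rewrite oppr_ge0.
  by move/H; rewrite sinN -opprD !normrN.
rewrite distrC !ger0_norm ?id_sub_sin_le// subr_ge0 sin_le_id//.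
Qed.

(** For [|x| <= 1] the cubic bound is already quadratic. The constant 2 comes from [|x| >= 1], where
    the triangle inequality gives 2 |x|, hence at most 2 x^2. *)
Lemma sin_taylor_bound2 x : `|sin x - x| <= 2 * x ^+ 2.
Proof.
have -> : x ^+ 2 = `|x| ^+ 2 by rewrite real_normK ?num_real.
have [x1|/ltW x1] := leP `|x| 1.
  apply: (le_trans (sin_taylor_bound3 x)).
  have : `|x| ^+ 3 <= `|x| ^+ 2 by rewrite exprS ler_piMl// exprn_ge0.
  have : 0 <= `|x| ^+ 2 by rewrite exprn_ge0.
  lra.
apply: (le_trans (ler_normB _ _)).
have := norm_sin_le x; have : `|x| <= `|x| ^+ 2 by rewrite ler_eXnr.
lra.
Qed.

Lemma sqr_sin_le x : sin x ^+ 2 <= x ^+ 2.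
Proof.
by rewrite -(real_normK (num_real x)) -real_normK ?num_real// lerXn2r ?nnegrE ?norm_sin_le.
Qed.

Lemma expRN_taylor_bound x : 0 <= x -> `|expR (- x) - (1 - x)| <= x ^+ 2 / 2.
Proof.
move=> x0; rewrite ger0_norm; last by have := expR_ge1Dx (- x); lra.
rewrite -subr_ge0.
apply: (@ge0_of_derive_ge0 (fun y => y ^+ 2 / 2 - (expR (- y) - (1 - y)))
  (fun y => y + expR (- y) - 1)) x0 => //.
- move=> y; apply: is_derive_eq.
  by rewrite /GRing.scale/=; field.
- by rewrite oppr0 expR0; field.
- by move=> y _; have := expR_ge1Dx (- y); lra.
Qed.

(** Serves to keep the denominator 1 - q of the geometric bound above a multiple of 1 / n. *)
Lemma one_sub_expRN_ge x : 0 <= x <= 1 -> x / 2 <= 1 - expR (- x).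
Proof.
move=> /andP[x0 x1]; have := expRN_taylor_bound x0; rewrite ler_norml => /andP[_].
have : x ^+ 2 <= x by rewrite expr2 ler_piMl.
lra.
Qed.

End taylor.

(** * Weierstrass' theorem *)

Section weierstrass.
Context {R : realType}.
Implicit Types (f : R -> R) (g : nat -> R) (x y : R).

(** Uniform continuity handles close points; for [|x - y| >= d] the crude bound 2 M is absorbed by 2
    M (x - y)^2 / d^2. A quadratic modulus is wanted because the Bernstein operator is explicit on
    squares. *)
Lemma quadratic_modulus f (e : R) : continuous f -> 0 < e ->
  exists2 C, 0 <= C & forall x y, 0 <= x <= 1 -> 0 <= y <= 1 ->
    `|f x - f y| <= e + C * (x - y) ^+ 2.
Proof.
move=> cf e0.
have [M M0 fM] : exists2 M, 0 <= M & forall x, 0 <= x <= 1 -> `|f x| <= M.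
  have [|||c _ fc] := @compact_EVT_max _ _ (fun x => `|f x|) `[0, 1].
  - by exists 0; rewrite /= in_itv/= lexx ler01.
  - exact: segment_compact.
  - apply: continuous_subspaceT => x.
    by apply: continuous_comp; [exact: cf|exact: norm_continuous].
  - exists `|f c| => // x x01; apply: fc.
    by rewrite inE /= in_itv.
have [d d0 fd] : exists2 d, 0 < d & forall x y, 0 <= x <= 1 ->
    `|x - y| < d -> `|f x - f y| <= e.
  (* Heine's theorem from the covering form of compactness: if f varies by less than e / 2 within r
     of x, then radii d < r / 2 work for all points within r / 2 of x. *)
  have := (@segment_compact R 0 1); rewrite compact_near_coveringP.
  move/(_ R (0^'+)%R (fun d x => forall y, `|x - y| < d -> `|f x - f y| <= e)).
  case.
  - move=> x _.
    have := cf x; move/cvgrPdist_lt => /(_ (e / 2)).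
    rewrite divr_gt0// => /(_ isT) [r /= r0 fr].
    exists (ball x (r / 2), [set d | 0 < d < r / 2]) => /=.
      split; first by apply: nbhsx_ballx; rewrite divr_gt0.
      near=> z => /=; apply/andP; split => //.
      by near: z; apply: nbhs_right_lt; rewrite divr_gt0.
    move=> [z d] [/= xz /andP[d0 dr]] y zy.
    have fz : `|f x - f z| < e / 2 by apply: fr => /=; rewrite (lt_trans xz)//; lra.
    have fy : `|f x - f y| < e / 2.
      apply: fr => /=; rewrite (_ : x - y = (x - z) + (z - y)); last by ring.
      by rewrite (le_lt_trans (ler_normD _ _))//; move: xz; rewrite /ball/=; lra.
    rewrite (_ : f z - f y = - (f x - f z) + (f x - f y)); last by ring.
    by rewrite (le_trans (ler_normD _ _))// normrN; lra.
  - move=> r /= r0 fr; exists (r / 2) => [|x y x01 xy]; first by rewrite divr_gt0.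
    apply: (fr (r / 2)) xy => /=; rewrite ?divr_gt0 ?in_itv//=.
    by rewrite sub0r normrN gtr0_norm ?divr_gt0// ltr_pdivrMr//; lra.
exists (2 * M / d ^+ 2) => [|x y x01 y01].
  by rewrite divr_ge0 ?exprn_ge0 ?mulr_ge0// ltW.
have [xy|xy] := ltP `|x - y| d.
  rewrite (le_trans (fd _ _ x01 xy))// lerDl mulr_ge0 ?sqr_ge0//.
  by rewrite divr_ge0 ?exprn_ge0 ?mulr_ge0// ltW.
rewrite (@le_trans _ _ (2 * M))//.
  by rewrite (le_trans (ler_normB _ _))// mulr_natl mulr2n lerD ?fM.
rewrite (@le_trans _ _ (2 * M / d ^+ 2 * (x - y) ^+ 2)) ?lerDr//; last exact: ltW.
rewrite -[X in _ <= X]mulrA ler_peMr ?mulr_ge0// mulrC ler_pdivlMr ?exprn_gt0// mul1r.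
by rewrite -(real_normK (num_real (x - y))) lerXn2r ?nnegrE// ltW.
Unshelve. all: by end_near.
Qed.

(* The recursion is that of the expectation of [g] at a binomial variable of
   parameters [n] and [x]; at [g k = f (k / n)] this is Bernstein's polynomial. *)
Fixpoint bernstein (n : nat) (g : nat -> R) : {poly R} :=
  if n is n'.+1 then
    'X * bernstein n' (fun k => g k.+1) + (1 - 'X) * bernstein n' g
  else (g 0%N)%:P.

Lemma bernsteinS n g x : (bernstein n.+1 g).[x] =
  x * (bernstein n (fun k => g k.+1)).[x] + (1 - x) * (bernstein n g).[x].
Proof. by rewrite /= !hornerE. Qed.

Lemma bernstein_le n g h x : 0 <= x <= 1 -> (forall k, (k <= n)%N -> g k <= h k) ->
  (bernstein n g).[x] <= (bernstein n h).[x].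
Proof.
move=> /andP[x0 x1]; elim: n g h => [|n ih] g h gh; first by rewrite /= !hornerE gh.
rewrite !bernsteinS lerD// ler_wpM2l ?subr_ge0 ?ih// => k kn; apply: gh => //.
exact: leqW.
Qed.

Lemma bernsteinD n g h x : (bernstein n (fun k => g k + h k)).[x] =
  (bernstein n g).[x] + (bernstein n h).[x].
Proof.
elim: n g h => [|n ih] g h; first by rewrite /= !hornerE.
by rewrite !bernsteinS !ih; ring.
Qed.

Lemma bernsteinZ n c g x :
  (bernstein n (fun k => c * g k)).[x] = c * (bernstein n g).[x].
Proof.
elim: n g => [|n ih] g; first by rewrite /= !hornerE.
by rewrite !bernsteinS !ih; ring.
Qed.

Lemma bernstein_cst n c x : (bernstein n (fun=> c)).[x] = c.
Proof.
by elim: n => [|n ih]; [rewrite /= !hornerE|rewrite bernsteinS ih; ring].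
Qed.

(** Variance plus squared bias of a binomial variable. The centre [c] is arbitrary because the
    shifted branch of the recursion replaces it by [c - 1]. *)
Lemma bernstein_variance n c x : (bernstein n (fun k => (k%:R - c) ^+ 2)).[x] =
  n%:R * x * (1 - x) + (n%:R * x - c) ^+ 2.
Proof.
elim: n c => [|n ih] c; first by rewrite /= !hornerE; ring.
rewrite bernsteinS ih.
under [X in bernstein n X]eq_fun => k.
  rewrite (_ : k.+1%:R - c = k%:R - (c - 1)); last by rewrite -natr1; ring.
  over.
by rewrite ih -natr1; ring.
Qed.

Lemma weierstrass01 f (e : R) : continuous f -> 0 < e ->
  exists p : {poly R}, forall x, 0 <= x <= 1 -> `|f x - p.[x]| <= e.
Proof.
move=> cf e0.
have e20 : 0 < e / 2 by rewrite divr_gt0.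
have [C C0 fC] := quadratic_modulus cf e20.
have [n Cn] : exists n : nat, C / (e / 2) <= n.+1%:R.
  exists (Num.truncn (C / (e / 2))); rewrite ltW// truncnS_gt//.
exists (bernstein n.+1 (fun k => f (k%:R / n.+1%:R))) => x x01.
set N := n.+1 in Cn *.
have N0 : 0 < N%:R :> R by rewrite ltr0n.
have mod k : (k <= N)%N ->
    `|f x - f (k%:R / N%:R)| <= e / 2 + C / N%:R ^+ 2 * (k%:R - N%:R * x) ^+ 2.
  move=> kN; apply: (le_trans (fC _ _ x01 _)).
    by rewrite divr_ge0//= ler_pdivrMr// mul1r ler_nat.
  rewrite lerD2l le_eqVlt; apply/orP; left; apply/eqP.
  by field; rewrite gt_eqF.
set B := bernstein N.
(* Taking [s] to be 1 and -1 gives both sides of the absolute value from the monotonicity of the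
   operator alone. *)
have BE (s : R) : s * (f x - (B (fun k => f (k%:R / N%:R))).[x]) =
    (B (fun k => s * f x + (- s) * f (k%:R / N%:R))).[x].
  by rewrite /B bernsteinD bernstein_cst bernsteinZ; ring.
have Bsum : (B (fun k => e / 2 + C / N%:R ^+ 2 * (k%:R - N%:R * x) ^+ 2)).[x] <= e.
  rewrite /B bernsteinD bernstein_cst bernsteinZ bernstein_variance subrr.
  rewrite expr0n/= addr0.
  have -> : C / N%:R ^+ 2 * (N%:R * x * (1 - x)) = C / N%:R * (x * (1 - x)).
    by field; rewrite gt_eqF.
  have CN : C / N%:R <= e / 2 by rewrite ler_pdivrMr// mulrC -ler_pdivrMr.
  have xx : 0 <= x * (1 - x) <= 1 by case/andP: x01 => ? ?; nra.
  have : C / N%:R * (x * (1 - x)) <= C / N%:R.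
    by case/andP: xx => ? ?; rewrite ler_piMr// divr_ge0// ltW.
  lra.
rewrite ler_norml; apply/andP; split.
- rewrite lerNl -mulN1r BE; apply: le_trans Bsum; apply: bernstein_le => // k kN.
  by have := mod k kN; rewrite ler_norml => /andP[]; lra.
- rewrite -[leLHS]mul1r BE; apply: le_trans Bsum; apply: bernstein_le => // k kN.
  by have := mod k kN; rewrite ler_norml => /andP[]; lra.
Qed.

End weierstrass.

(** * Expectation of bounded measurable functions *)

Section bounded_measurable.
Context d (T : measurableType d) (R : realType).
Implicit Types f g : T -> R.

Definition bounded_measurable f :=
  measurable_fun setT f /\ exists M : R, forall x, `|f x| <= M.

Lemma bmcst (c : R) : bounded_measurable (fun=> c).
Proof. by split; [exact: measurable_cst|exists `|c|]. Qed.

Lemma bmD f g : bounded_measurable f -> bounded_measurable g ->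
  bounded_measurable (fun x => f x + g x).
Proof.
move=> [mf [M fM]] [mg [N gN]]; split; first exact: measurable_funD.
by exists (M + N) => x; rewrite (le_trans (ler_normD _ _))// lerD.
Qed.

Lemma bmM f g : bounded_measurable f -> bounded_measurable g ->
  bounded_measurable (fun x => f x * g x).
Proof.
move=> [mf [M fM]] [mg [N gN]]; split; first exact: measurable_funM.
by exists (M * N) => x; rewrite normrM ler_pM.
Qed.

Lemma bmZ (c : R) f : bounded_measurable f -> bounded_measurable (fun x => c * f x).
Proof. by move=> bf; apply: bmM => //; exact: bmcst. Qed.

Lemma bmN f : bounded_measurable f -> bounded_measurable (fun x => - f x).
Proof. by move=> /(bmZ (-1)); under eq_fun do rewrite mulN1r. Qed.

Lemma bmB f g : bounded_measurable f -> bounded_measurable g ->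
  bounded_measurable (fun x => f x - g x).
Proof. by move=> bf /bmN; exact: bmD. Qed.

Lemma bmX f n : bounded_measurable f -> bounded_measurable (fun x => f x ^+ n).
Proof.
move=> bf; elim: n => [|n ih]; first exact: bmcst.
by under eq_fun do rewrite exprS; exact: bmM.
Qed.

Lemma bm_norm f : bounded_measurable f -> bounded_measurable (fun x => `|f x|).
Proof.
move=> [mf [M fM]]; split; first exact: measurableT_comp.
by exists M => x; rewrite normr_id.
Qed.

End bounded_measurable.

Lemma bm_comp d1 d2 (T1 : measurableType d1) (T2 : measurableType d2)
    (R : realType) (f : T2 -> R) (g : T1 -> T2) :
  bounded_measurable f -> measurable_fun setT g -> bounded_measurable (f \o g).
Proof.
by move=> [mf [M fM]] mg; split; [exact: measurableT_comp|exists M => x; exact: fM].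
Qed.

Lemma bounded_funP T (R : realType) (f : T -> R) :
  bounded_fun f <-> exists M : R, forall x, `|f x| <= M.
Proof.
split=> [[M [_ Mf]]|[M fM]].
  by exists (M + 1) => x; apply: Mf => //; rewrite ltrDl.
by exists M; split=> [|N MN x _ /=]; rewrite ?num_real// (le_trans (fM x))// ltW.
Qed.

Lemma bounded_fun_gt0 T (R : realType) (f : T -> R) :
  bounded_fun f -> exists2 M : R, 0 < M & forall x, `|f x| <= M.
Proof.
move=> /bounded_funP[M fM]; exists (`|M| + 1); first by rewrite ltr_wpDl.
by move=> x; rewrite (le_trans (fM x))// (le_trans (ler_norm _))// lerDl.
Qed.

Lemma bm_continuous (R : realType) (f : R -> R) : continuous f ->
  (exists M : R, forall x, `|f x| <= M) -> bounded_measurable f.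
Proof. by move=> cf fM; split => //; exact: continuous_measurable_fun. Qed.

Lemma bm_cos (R : realType) (t b : R) : bounded_measurable (fun x => cos (t * x + b)).
Proof.
apply: bm_continuous => [x|]; last by exists 1 => x; exact: cos_max.
apply: continuous_comp; last exact: continuous_cos.
by apply: cvgD; [apply: cvgMr; exact: cvg_id|exact: cvg_cst].
Qed.

Lemma Rintegral_dominated_cvg d (T : measurableType d) (R : realType)
    (mu : {measure set T -> \bar R}) (f_ : nat -> T -> R) (f g : T -> R) :
  (forall n, measurable_fun setT (f_ n)) -> measurable_fun setT f ->
  mu.-integrable setT (EFin \o g) ->
  (forall x, f_ n x @[n --> \oo] --> f x) ->
  (forall n x, `|f_ n x| <= g x) -> (forall x, `|f x| <= g x) ->
  \int[mu]_x f_ n x @[n --> \oo] --> \int[mu]_x f x.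
Proof.
move=> mf_ mf ig f_f f_g fg; apply: fine_cvg; rewrite fineK.
  apply: (@dominated_cvg _ _ _ mu _ measurableT (fun n => EFin \o f_ n) _ (EFin \o g)) => //.
  - by move=> n; exact/measurable_EFinP.
  - by move=> x _; apply: cvg_EFin; [exact: nearW|exact: f_f].
  - by move=> n x _; rewrite /= lee_fin f_g.
apply: integrable_fin_num => //; apply: le_integrable ig => //.
  exact/measurable_EFinP.
by move=> x _; rewrite /= lee_fin (le_trans (fg x))// ler_norm.
Qed.

Lemma bm_cosM (R : realType) (t : R) : bounded_measurable (fun x => cos (t * x)).
Proof. by have := bm_cos t 0; under eq_fun do rewrite addr0. Qed.

Lemma bm_sinM (R : realType) (t : R) : bounded_measurable (fun x => sin (t * x)).
Proof.
apply: bm_continuous => [x|]; last by exists 1 => x; exact: sin_max.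
by apply: continuous_comp; [apply: cvgMr; exact: cvg_id|exact: continuous_sin].
Qed.

Section probability_integral.
Context d (T : measurableType d) (R : realType) (P : probability T R).
Implicit Types f g : T -> R.

Lemma bm_integrable f : bounded_measurable f -> P.-integrable setT (EFin \o f).
Proof.
move=> [mf bf]; apply: measurable_bounded_integrable => //.
  by rewrite [X in (X < _)%E]probability_setT ltry.
exact/bounded_funP.
Qed.

Lemma bm_expectation f : bounded_measurable f -> ('E_P[f] = (\int[P]_x f x)%:E)%E.
Proof.
move=> bf; rewrite unlock /Rintegral fineK//; apply: integrable_fin_num => //.
exact: bm_integrable.
Qed.

Lemma bm_RintegralD f g : bounded_measurable f -> bounded_measurable g ->
  \int[P]_x (f x + g x) = \int[P]_x f x + \int[P]_x g x.
Proof. by move=> bf bg; rewrite RintegralD//; exact: bm_integrable. Qed.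

Lemma bm_RintegralB f g : bounded_measurable f -> bounded_measurable g ->
  \int[P]_x (f x - g x) = \int[P]_x f x - \int[P]_x g x.
Proof. by move=> bf bg; rewrite RintegralB//; exact: bm_integrable. Qed.

Lemma bm_RintegralZ c f : bounded_measurable f ->
  \int[P]_x (c * f x) = c * \int[P]_x f x.
Proof. by move=> bf; rewrite RintegralZl//; exact: bm_integrable. Qed.

Lemma Rintegral_probability_cst (c : R) : \int[P]_x c = c.
Proof. by rewrite Rintegral_cst//= [X in fine X]probability_setT mulr1. Qed.

Lemma bm_le_Rintegral f g : bounded_measurable f -> bounded_measurable g ->
  (forall x, f x <= g x) -> \int[P]_x f x <= \int[P]_x g x.
Proof. by move=> bf bg fg; apply: le_Rintegral => //; exact: bm_integrable. Qed.

Lemma bm_norm_RintegralB f g h : bounded_measurable f -> bounded_measurable g ->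
  bounded_measurable h -> (forall x, `|f x - g x| <= h x) ->
  `|\int[P]_x f x - \int[P]_x g x| <= \int[P]_x h x.
Proof.
move=> bf bg bh fgh; rewrite -bm_RintegralB//.
have bfg := bmB bf bg.
apply: le_trans (le_normr_Rintegral _ (bm_integrable bfg)) _ => //.
by apply: bm_le_Rintegral => //; exact: bm_norm.
Qed.

Lemma norm_Rintegral_le1 f : bounded_measurable f ->
  (forall x, `|f x| <= 1) -> `|\int[P]_x f x| <= 1.
Proof.
move=> bf f1; rewrite -[leRHS]Rintegral_probability_cst -[X in `|X|]subr0.
rewrite -[X in `|_ - X|]Rintegral_probability_cst.
by apply: bm_norm_RintegralB => [//|||x]; rewrite ?subr0//; exact: bmcst.
Qed.

End probability_integral.

(** * Convergence on test functions *)

Section convergence_of_test_functions.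
Context d1 d2 (T1 : measurableType d1) (T2 : measurableType d2) (R : realType)
  (P1 : probability T1 R) (P2 : probability T2 R)
  (Y : nat -> T1 -> R) (Y' : T2 -> R)
  (mY : forall n, measurable_fun setT (Y n)) (mY' : measurable_fun setT Y').
Implicit Types (f g h : R -> R).

Definition converges_on f := bounded_measurable f /\
  \int[P1]_w f (Y n w) @[n --> \oo] --> \int[P2]_w f (Y' w).

Let bmY f n : bounded_measurable f -> bounded_measurable (fun w => f (Y n w)).
Proof. by move=> bf; exact: bm_comp. Qed.

Let bmY' f : bounded_measurable f -> bounded_measurable (fun w => f (Y' w)).
Proof. by move=> bf; exact: bm_comp. Qed.

Lemma converges_on_cst c : converges_on (fun=> c).
Proof.
split; first exact: bmcst.
by rewrite !Rintegral_probability_cst; exact: cvg_cst.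
Qed.

Lemma converges_onD f g : converges_on f -> converges_on g ->
  converges_on (fun x => f x + g x).
Proof.
move=> [bf cf] [bg cg]; split; first exact: bmD.
rewrite (bm_RintegralD _ (bmY' bf) (bmY' bg)).
under eq_fun do rewrite (bm_RintegralD _ (bmY _ bf) (bmY _ bg)).
exact: cvgD.
Qed.

Lemma converges_onZ c f : converges_on f -> converges_on (fun x => c * f x).
Proof.
move=> [bf cf]; split; first exact: bmZ.
rewrite (bm_RintegralZ _ _ (bmY' bf)).
under eq_fun do rewrite (bm_RintegralZ _ _ (bmY _ bf)).
exact: cvgMr.
Qed.

(** The factor [f] is the constant 1 for Laplace transforms. Characteristic functions also use
    [cos (c * x)], since polynomials in a sine cannot separate a point from its mirror image about a
    quarter period. *)
Lemma converges_on_poly f h (p : {poly R}) :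
  (forall j, converges_on (fun x => f x * h x ^+ j)) ->
  converges_on (fun x => f x * p.[h x]).
Proof.
move=> fh.
suff sum n : converges_on (fun x => f x * \sum_(i < n) p`_i * h x ^+ i).
  by under eq_fun do rewrite horner_coef.
elim: n => [|n ih].
  by under eq_fun do rewrite big_ord0 mulr0; exact: converges_on_cst.
under eq_fun do rewrite big_ord_recr/= mulrDr.
apply: converges_onD => //.
by under eq_fun do rewrite mulrCA; exact: converges_onZ.
Qed.

Lemma converges_on_approx (D : set R) f :
  (forall n w, D (Y n w)) -> (forall w, D (Y' w)) ->
  bounded_measurable f ->
  (forall e : R, 0 < e -> exists h g, [/\ converges_on h, converges_on g,
    forall x, D x -> `|f x - h x| <= g x & \int[P2]_w g (Y' w) <= e]) ->
  converges_on f.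
Proof.
move=> DY DY' bf approx; split => //; apply/cvgrPdist_lt => e e0.
(* Four quarters: the expectation of [g] at the limit law occurs twice, once directly and once in
   bounding the one under [Y n]; the other two are the gaps for [h] and for [g]. *)
have e40 : 0 < e / 4 by rewrite divr_gt0.
have [h [g [[bh ch] [bg cg] fhg ge]]] := approx _ e40.
near=> n.
have fhY : `|\int[P1]_w f (Y n w) - \int[P1]_w h (Y n w)| <= \int[P1]_w g (Y n w).
  apply: bm_norm_RintegralB; rewrite ?bmY//; try exact: bmY.
  by move=> w; exact: fhg.
have fhY' : `|\int[P2]_w f (Y' w) - \int[P2]_w h (Y' w)| <= \int[P2]_w g (Y' w).
  by apply: bm_norm_RintegralB; try exact: bmY'; move=> w; exact: fhg.
have hh : `|\int[P2]_w h (Y' w) - \int[P1]_w h (Y n w)| < e / 4.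
  by near: n; move/cvgrPdist_lt : ch; apply.
have gg : `|\int[P2]_w g (Y' w) - \int[P1]_w g (Y n w)| < e / 4.
  by near: n; move/cvgrPdist_lt : cg; apply.
move: fhY fhY' hh gg; rewrite !ler_norml !ltr_norml.
by move=> /andP[? ?] /andP[? ?] /andP[? ?] /andP[? ?]; apply/andP; split; lra.
Unshelve. all: by end_near. Qed.

Lemma cvg_in_distributionP :
  cvg_in_distribution P1 P2 Y Y' <->
  (forall f, continuous f -> bounded_fun f -> converges_on f).
Proof.
split=> [YY' f cf fb|YY' f cf fb].
- have bf := bm_continuous cf (proj1 (bounded_funP _) fb).
  split=> //; have := YY' f cf fb.
  rewrite (bm_expectation _ (bmY' bf)).
  under eq_fun do rewrite (bm_expectation _ (bmY _ bf)).
  exact: fine_cvg.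
- have [bf cvf] := YY' f cf fb.
  rewrite (bm_expectation _ (bmY' bf)).
  under eq_fun do rewrite (bm_expectation _ (bmY _ bf)).
  by apply: cvg_EFin; [exact: nearW|exact: cvf].
Qed.

(** Used to fix the scale of the squeezing map: the error function tends to 0 pointwise as the scale
    grows, hence so does its expectation at the limit law. *)
Lemma Rintegral_vanishing (g : nat -> R -> R) :
  (forall k, measurable_fun setT (g k)) -> (forall k x, 0 <= g k x <= 1) ->
  (forall x, g k x @[k --> \oo] --> 0) ->
  forall e : R, 0 < e -> exists k, \int[P2]_w g k (Y' w) < e.
Proof.
move=> mg g01 g0 e e0.
have : \int[P2]_w g k (Y' w) @[k --> \oo] --> \int[P2]_w (fun=> 0) w.
  apply: (@Rintegral_dominated_cvg _ _ _ _ _ _ (fun=> 1)) => //.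
  - by move=> k; exact: measurableT_comp.
  - by apply: bm_integrable; exact: bmcst.
  - by move=> k w; have /andP[? ?] := g01 k (Y' w); rewrite ger0_norm.
  - by move=> w; rewrite normr0.
rewrite Rintegral_probability_cst => /cvgrPdist_lt /(_ _ e0) [k _ /(_ k (leqnn k))].
by rewrite sub0r normrN => ke; exists k; rewrite (le_lt_trans (ler_norm _)).
Qed.

End convergence_of_test_functions.

(** * Continuity theorem for Laplace transforms *)

(** Points at infinity become endpoints of the compact interval, where the transported test function
    [a] may have no limit. A weight [w] vanishing there restores continuity. *)
Lemma continuousM_bounded (R : realType) (a w : R -> R) (M : R) :
  continuous w -> (forall x, `|a x| <= M) ->
  (forall x, w x != 0 -> {for x, continuous a}) ->
  continuous (fun x => a x * w x).
Proof.
move=> cw aM ca x; have [w0|w0] := eqVneq (w x) 0; last first.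
  by apply: cvgM; [exact: ca|exact: cw].
rewrite /continuous_at w0 mulr0; apply/cvgr0Pnorm_lt => e e0.
have M0 : 0 <= M by exact: le_trans (aM x).
have := cw x; rewrite /continuous_at w0 => /cvgr0Pnorm_lt /(_ (e / (M + 1))).
rewrite divr_gt0 ?ltr_wpDl// => /(_ isT); apply: filterS => y.
rewrite ltr_pdivlMr ?ltr_wpDl// => ye; rewrite normrM (le_lt_trans _ ye)//.
by rewrite mulrC ler_wpM2l// (le_trans (aM y))// lerDl.
Qed.

Section laplace_continuity.
Context d1 d2 (T1 : measurableType d1) (T2 : measurableType d2) (R : realType)
  (P1 : probability T1 R) (P2 : probability T2 R)
  (Y : nat -> T1 -> R) (Y' : T2 -> R).

(** The absolute value makes [u k] bounded on the whole line, as a test function must be; on the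
    half-line its powers are Laplace kernels. *)
Let u (k : nat) (x : R) := expR (- (k.+1%:R)^-1 * `|x|).

Let u01 k x : 0 < u k x <= 1.
Proof.
by rewrite expR_gt0/= -expR0 ler_expR mulNr oppr_le0 mulr_ge0.
Qed.

Let continuous_u k : continuous (u k).
Proof.
move=> x; apply: continuous_comp; last exact: continuous_expR.
by apply: cvgMr; exact: norm_continuous.
Qed.

Let bm_u k : bounded_measurable (u k).
Proof.
apply: bm_continuous; first exact: continuous_u.
by exists 1 => x; have /andP[? ?] := u01 k x; rewrite gtr0_norm.
Qed.

Lemma laplace_continuity :
  (forall n, measurable_fun setT (Y n)) -> measurable_fun setT Y' ->
  (forall n w, 0 <= Y n w) -> (forall w, 0 <= Y' w) ->
  (forall s : R, 0 <= s -> \int[P1]_w expR (- s * Y n w) @[n --> \oo] -->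
                       \int[P2]_w expR (- s * Y' w)) ->
  cvg_in_distribution P1 P2 Y Y'.
Proof.
move=> mY mY' Y0 Y'0 laplace; apply/cvg_in_distributionP => // f cf bf.
have bmf := bm_continuous cf (proj1 (bounded_funP _) bf).
have [M M0 fM] := bounded_fun_gt0 bf.
apply: (@converges_on_approx _ _ _ _ _ _ _ _ _ mY mY' [set x | 0 <= x]) => // e e0.
have [k ke] : exists k, \int[P2]_w (1 - u k (Y' w)) < e / (2 * M).
  apply: (@Rintegral_vanishing _ _ _ P2 _ mY' (fun k x => 1 - u k x)).
  - by move=> k; have [] := bmB (bmcst _ 1) (bm_u k).
  - by move=> k x; have /andP[? ?] := u01 k x; apply/andP; split; lra.
  - move=> x; rewrite -(subrr 1); apply: cvgB; first exact: cvg_cst.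
    rewrite -expR0; apply: continuous_cvg; first exact: continuous_expR.
    rewrite -(mul0r `|x|) -oppr0; apply: cvgMl; apply: cvgN.
    exact: cvg_harmonic.
  - by rewrite divr_gt0// mulr_gt0.
pose K : R := k.+1%:R; have K0 : 0 < K by rewrite ltr0n.
pose G v := f (- K * ln v) * Num.max v 0.
have cG : continuous G.
  apply: (@continuousM_bounded _ _ _ M) => // [x|x xneq0].
    by apply: (@continuous_max _ _ id (fun=> 0)); [exact: cvg_id|exact: cvg_cst].
  have x0 : 0 < x by rewrite ltNge; apply: contra xneq0 => x0; rewrite max_r.
  apply: continuous_comp; last exact: cf.
  by apply: cvgMr; exact: continuous_ln.
have [p pG] := weierstrass01 cG (divr_gt0 e0 (ltr0n R 2)).
have convu j : converges_on P1 P2 Y Y' (fun x => 1 * u k x ^+ j).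
  split; first by apply: bmM; [exact: bmcst|exact: bmX].
  have E x : 0 <= x -> 1 * u k x ^+ j = expR (- (j%:R / K) * x).
    move=> x0; rewrite mul1r -expRM_natl ger0_norm// /K; congr expR; ring.
  have := laplace (j%:R / K); rewrite divr_ge0 ?(ltW K0)// => /(_ isT).
  rewrite (@eq_Rintegral _ _ _ P2 _ (fun w => 1 * u k (Y' w) ^+ j)) => [|w _].
    apply: cvg_trans; apply: near_eq_cvg; near=> n.
    by apply: eq_Rintegral => w _; rewrite E.
  by rewrite E.
exists (fun x => 1 * p.[u k x]), (fun x => M * (1 - u k x) + e / 2); split.
- exact: converges_on_poly.
- apply: converges_onD => //; last exact: converges_on_cst.
  apply: converges_onZ => //; apply: converges_onD => //; first exact: converges_on_cst.
  have := converges_onZ mY mY' (-1) (convu 1%N).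
  by under eq_fun do rewrite mul1r expr1 mulN1r.
- move=> x /= x0; rewrite mul1r.
  have /andP[ux0 ux1] := u01 k x.
  (* Only [f x * u k x] is approximated by the polynomial; the rest [f x * (1 - u k x)] is charged
     to the error function. *)
  have -> : f x - p.[u k x] = f x * (1 - u k x) + (G (u k x) - p.[u k x]).
    rewrite /G max_l ?ltW// {3}/u expRK ger0_norm//.
    rewrite (_ : - K * _ = x); first by ring.
    by rewrite /K; field; rewrite addrC natr1 gt_eqF.
  rewrite (le_trans (ler_normD _ _))// lerD//.
    by rewrite normrM (@ger0_norm _ (1 - _)) ?subr_ge0// ler_wpM2r ?subr_ge0.
  by apply: pG; rewrite ux1 ltW.
- have b1u : bounded_measurable (fun w => 1 - u k (Y' w)).
    by apply: bmB; [exact: bmcst|exact: bm_comp].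
  rewrite bm_RintegralD; [|exact: bmZ|exact: bmcst].
  rewrite bm_RintegralZ// Rintegral_probability_cst.
  have : M * (\int[P2]_w (1 - u k (Y' w))) <= M * (e / (2 * M)).
    by rewrite ler_wpM2l ?ltW.
  by rewrite (_ : M * (e / _) = e / 2); [lra|field; rewrite gt_eqF].
Unshelve. all: by end_near. Qed.

End laplace_continuity.

(** * Continuity theorem for characteristic functions *)

Section exponential_average.
Context {R : realType}.
Notation mu := (@lebesgue_measure R).
Local Notation pdf := (@exponential_pdf R 1).

Lemma expRN_cvg0 : expR (- t) @[t --> +oo%R] --> (0 : R).
Proof. exact: cvgr_expR. Qed.

(** Exhibits y^2 / (1 + y^2) as an average of 1 - cos(t y) over an exponential frequency t, so that
    its expectation is governed by the real part of the characteristic function. *)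
Lemma integral_exponential_one_sub_cos (y : R) :
  (\int[mu]_t ((1 - cos (t * y)) * pdf t)%:E = (y ^+ 2 / (1 + y ^+ 2))%:E)%E.
Proof.
have y10 : 0 < 1 + y ^+ 2 by rewrite ltr_pwDl// sqr_ge0.
pose f (t : R) := (1 - cos (t * y)) * expR (- t).
(* [expR (- t) * g t] is an antiderivative of [expR (- t) * cos (t * y)]. *)
pose g (t : R) := (y * sin (t * y) - cos (t * y)) / (1 + y ^+ 2).
pose F (t : R) := - expR (- t) * (1 + g t).
have dF (t : R) : is_derive t (1 : R) F (f t).
  rewrite /F /f /g; apply: is_derive_eq.
  by rewrite /GRing.scale/=; field; rewrite gt_eqF.
have -> : (fun t => ((1 - cos (t * y)) * pdf t)%:E) =
    (fun t => (f t)%:E) \_ `[0, +oo[.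
  apply/funext => t; rewrite patchE; have [t0|t0] := leP 0 t.
    rewrite ifT; last by rewrite inE/= in_itv/= t0.
    by rewrite exponential_pdfE// /f mul1r mulNr mul1r.
  rewrite lt0_exponential_pdf// mulr0 ifF//.
  by apply/negbTE; rewrite notin_setE/= in_itv/= leNgt t0.
rewrite -integral_mkcond.
rewrite (@ge0_continuous_FTC2y _ f F 0 0).
- rewrite sub0e /F /g oppr0 mul0r expR0 sin0 cos0 -EFinN; congr EFin.
  by field; rewrite gt_eqF.
- by move=> t _; rewrite mulr_ge0 ?expR_ge0// subr_ge0 cos_le1.
- apply: continuous_subspaceT => t; rewrite /f; apply: cvgM.
    apply: cvgB; first exact: cvg_cst.
    apply: continuous_comp; last exact: continuous_cos.
    by apply: cvgMl; exact: cvg_id.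
  apply: continuous_comp; last exact: continuous_expR.
  by apply: cvgN; exact: cvg_id.
- have c0 : 0 < 1 + (`|y| + 1) / (1 + y ^+ 2).
    by rewrite ltr_pwDl// divr_ge0 ?(ltW y10)// addr_ge0.
  have gb t : `|1 + g t| <= 1 + (`|y| + 1) / (1 + y ^+ 2).
    rewrite (le_trans (ler_normD _ _))// normr1 lerD2l normrM.
    rewrite [X in _ * X]ger0_norm ?invr_ge0 ?(ltW y10)//.
    rewrite ler_wpM2r ?invr_ge0 ?(ltW y10)//.
    rewrite (le_trans (ler_normB _ _))// lerD ?cos_max// normrM.
    by rewrite ler_piMr// sin_max.
  apply/cvgr0Pnorm_le => e e0; near=> t.
  rewrite /F normrM normrN (@ger0_norm _ (expR _)) ?expR_ge0//.
  rewrite (le_trans (ler_wpM2l (expR_ge0 _) (gb t)))//.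
  rewrite -ler_pdivlMr//.
  apply: ltW; near: t.
  have /cvgr0_norm_lt := expRN_cvg0.
  move=> /(_ (e / (1 + (`|y| + 1) / (1 + y ^+ 2)))).
  rewrite divr_gt0//.
  by move=> /(_ isT); apply: filterS => t; rewrite ger0_norm ?expR_ge0.
- by move=> t _; have [] := dF t.
- apply: cvg_at_right_filter.
  by apply: differentiable_continuous; apply/derivable1_diffP; have [] := dF 0.
- by move=> t _; rewrite derive1E (@derive_val _ _ _ _ _ _ _ (dF t)).
Unshelve. all: by end_near. Qed.

End exponential_average.

Section truncated_square.
Context {R : realType}.
Implicit Types (x y : R).

(** Comparable with min(1, x^2): small near 0 to second order and bounded below away from 0, which
    is the shape of the error made by periodizing a test function. *)
Definition truncated_square x := x ^+ 2 / (1 + x ^+ 2).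

Let den_gt0 x : 0 < 1 + x ^+ 2.
Proof. by rewrite ltr_pwDl// sqr_ge0. Qed.

Lemma truncated_square01 x : 0 <= truncated_square x <= 1.
Proof.
rewrite divr_ge0 ?sqr_ge0 ?(ltW (den_gt0 x))//=.
by rewrite ler_pdivrMr// mul1r lerDr.
Qed.

Lemma truncated_square_ge x : `|x| <= 1 -> x ^+ 2 / 2 <= truncated_square x.
Proof.
move=> x1; have x21 : x ^+ 2 <= 1.
  by rewrite -(real_normK (num_real x)) -(expr1n R 2) lerXn2r ?nnegrE.
rewrite ler_wpM2l ?sqr_ge0// lef_pV2 ?posrE//; lra.
Qed.

Lemma truncated_square_ge_half x : 1 <= `|x| -> 1 / 2 <= truncated_square x.
Proof.
move=> x1; have x21 : 1 <= x ^+ 2.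
  by rewrite -(real_normK (num_real x)) -(expr1n R 2) lerXn2r ?nnegrE.
by rewrite ler_pdivlMr//; lra.
Qed.

Lemma continuous_truncated_square : continuous truncated_square.
Proof.
move=> x; apply: cvgM; first exact: exprn_continuous.
apply: cvgV; first by rewrite gt_eqF.
by apply: cvgD; [exact: cvg_cst|exact: exprn_continuous].
Qed.

Lemma bm_truncated_square : bounded_measurable truncated_square.
Proof.
apply: bm_continuous; first exact: continuous_truncated_square.
by exists 1 => x; have /andP[? ?] := truncated_square01 x; rewrite ger0_norm.
Qed.

End truncated_square.

Section truncated_square_expectation.
Context d (T : measurableType d) (R : realType) (P : probability T R)
  (Y : T -> R) (mY : measurable_fun setT Y).
Notation mu := (@lebesgue_measure R).
Local Notation pdf := (@exponential_pdf R 1).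

Let bmcosY t : bounded_measurable (fun w => cos (t * Y w)).
Proof. exact: (bm_comp (bm_cosM t) mY). Qed.

Let k (z : T * R) : \bar R := ((1 - cos (z.2 * Y z.1)) * pdf z.2)%:E.

Let mk : measurable_fun setT k.
Proof.
apply/measurable_EFinP; apply: measurable_funM.
  apply: measurable_funB; first exact: measurable_cst.
  have mcos : measurable_fun setT (@cos R).
    by apply: continuous_measurable_fun; exact: continuous_cos.
  apply: measurableT_comp => //; apply: measurable_funM; first exact: measurable_snd.
  by apply: measurableT_comp => //; exact: measurable_fst.
by apply: measurableT_comp; [exact: measurable_exponential_pdf|exact: measurable_snd].
Qed.

Let k0 z : (0 <= k z)%E.
Proof. by rewrite lee_fin mulr_ge0 ?exponential_pdf_ge0// subr_ge0 cos_le1. Qed.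

Let inner t : (\int[P]_w k (w, t) = ((1 - \int[P]_w cos (t * Y w)) * pdf t)%:E)%E.
Proof.
have b1 : bounded_measurable (fun w => 1 - cos (t * Y w)).
  by apply: bmB; [exact: bmcst|exact: bmcosY].
rewrite /k/=; under eq_integral do rewrite mulrC.
have := bm_expectation P (bmZ (pdf t) b1); rewrite unlock => ->; congr EFin.
rewrite bm_RintegralZ// bm_RintegralB//; last exact: bmcst.
by rewrite Rintegral_probability_cst mulrC.
Qed.

Lemma measurable_Rintegral_cos :
  measurable_fun setT (fun t : R => (1 - \int[P]_w cos (t * Y w)) * pdf t).
Proof.
apply/measurable_EFinP.
have := measurable_fun_fubini_tonelli_G (m1 := P) k mk k0.
by apply: eq_measurable_fun => t _; rewrite /fubini_G inner.
Qed.

(** Tonelli's theorem, available because 1 - cos is nonnegative; it also yields the measurability in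
    [t] stated before. *)
Lemma Rintegral_truncated_square : \int[P]_w truncated_square (Y w) =
  \int[mu]_t ((1 - \int[P]_w cos (t * Y w)) * pdf t).
Proof.
rewrite /Rintegral; congr fine.
under eq_integral do rewrite -integral_exponential_one_sub_cos.
rewrite (fubini_tonelli (m1 := P) (m2 := mu) k mk k0).
by apply: eq_integral => t _; rewrite inner.
Qed.

End truncated_square_expectation.

Section levy_continuity.
Context d1 d2 (T1 : measurableType d1) (T2 : measurableType d2) (R : realType)
  (P1 : probability T1 R) (P2 : probability T2 R)
  (Y : nat -> T1 -> R) (Y' : T2 -> R)
  (mY : forall n, measurable_fun setT (Y n)) (mY' : measurable_fun setT Y')
  (cos_cvg : forall t : R, \int[P1]_w cos (t * Y n w) @[n --> \oo] -->
    \int[P2]_w cos (t * Y' w))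
  (sin_cvg : forall t : R, \int[P1]_w sin (t * Y n w) @[n --> \oo] -->
    \int[P2]_w sin (t * Y' w)).
Notation mu := (@lebesgue_measure R).
Local Notation pdf := (@exponential_pdf R 1).

Lemma converges_on_cos (t b : R) :
  converges_on P1 P2 Y Y' (fun x => cos (t * x + b)).
Proof.
have convc : converges_on P1 P2 Y Y' (fun x => cos (t * x)).
  by split; [exact: bm_cosM|exact: cos_cvg].
have convs : converges_on P1 P2 Y Y' (fun x => sin (t * x)).
  by split; [exact: bm_sinM|exact: sin_cvg].
rewrite (_ : (fun x => _) = (fun x => cos b * cos (t * x) + - sin b * sin (t * x))).
  by apply: converges_onD => //; exact: converges_onZ.
by apply/funext => x; rewrite cosD; ring.
Qed.

(** Multiplying a cosine by [sin (c * x)] gives cosines with frequency and phase changed, so the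
    family over all [t] and [b] is stable and the induction must quantify over both. *)
Lemma converges_on_cos_sinX (c : R) (j : nat) : forall t b : R,
  converges_on P1 P2 Y Y' (fun x => cos (t * x + b) * ((1 + sin (c * x)) / 2) ^+ j).
Proof.
elim: j => [|j ih] t b.
  by under eq_fun do rewrite expr0 mulr1; exact: converges_on_cos.
pose r t b (x : R) := cos (t * x + b) * ((1 + sin (c * x)) / 2) ^+ j.
(* From sin A cos B = (sin (A + B) + sin (A - B)) / 2, each sine being a cosine delayed by pi /
   2. *)
rewrite (_ : (fun x => _) = (fun x => 1 / 2 * r t b x +
    (1 / 4 * r (c + t) (b - pi / 2) x + 1 / 4 * r (c - t) (- b - pi / 2) x))).
  apply: converges_onD => //; last apply: converges_onD => //;
    by apply: converges_onZ => //; exact: ih.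
apply/funext => x; rewrite /r.
have E u v : u + (v - pi / 2) = (u + v) - pi / 2 :> R by ring.
rewrite !E !cosBpihalf exprS.
rewrite (_ : (c + t) * x + b = c * x + (t * x + b)); last by ring.
rewrite (_ : (c - t) * x - b = c * x - (t * x + b)); last by ring.
by rewrite sinD sinB; field.
Qed.

(** Dominated convergence in the frequency variable: the integrands converge for each [t] by
    hypothesis and are at most twice the exponential density. *)
Lemma truncated_square_cvg (K : R) :
  converges_on P1 P2 Y Y' (fun x => truncated_square (x / K)).
Proof.
have cK : measurable_fun setT (fun x : R => x / K).
  by apply: measurable_funM; [exact: measurable_id|exact: measurable_cst].
split; first exact: (bm_comp bm_truncated_square cK).
have mYK n : measurable_fun setT (fun w => Y n w / K).
  exact: (measurableT_comp cK (mY n)).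
have mYK' : measurable_fun setT (fun w => Y' w / K).
  exact: (measurableT_comp cK mY').
rewrite (Rintegral_truncated_square P2 mYK').
under eq_fun do rewrite (Rintegral_truncated_square P1 (mYK _)).
have cosK (t y : R) : cos (t * (y / K)) = cos (t / K * y) by congr cos; ring.
have bound d (T : measurableType d) (P : probability T R) (V : T -> R) (t : R) :
    measurable_fun setT V ->
    `|(1 - \int[P]_w cos (t * V w)) * pdf t| <= 2 * pdf t.
  move=> mV; rewrite normrM (@ger0_norm _ (pdf t)) ?exponential_pdf_ge0//.
  rewrite ler_wpM2r ?exponential_pdf_ge0// (le_trans (ler_normB _ _))//.
  rewrite normr1 (_ : 2 = 1 + 1) // lerD2l norm_Rintegral_le1// => [|w].
    exact: (bm_comp (bm_cosM t) mV).
  exact: cos_max.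
apply: (@Rintegral_dominated_cvg _ _ _ mu _ _ (fun t => 2 * pdf t)).
- by move=> n; exact: measurable_Rintegral_cos.
- exact: measurable_Rintegral_cos.
- rewrite [X in integrable _ _ X](_ : _ = (fun t => 2%:E * (pdf t)%:E)%E) //.
  by apply: integrableZl => //; exact: integrable_exponential_pdf.
- move=> t; apply: cvgMl; apply: cvgB; first exact: cvg_cst.
  rewrite (_ : (fun w => cos (t * (Y' w / K))) = (fun w => cos (t / K * Y' w))).
    rewrite (_ : (fun n => _) = (fun n => \int[P1]_w cos (t / K * Y n w))) //.
    by apply/funext => n; apply: eq_Rintegral => w _; rewrite cosK.
  by apply/funext => w; rewrite cosK.
- by move=> n t; exact: bound.
- by move=> t; exact: bound.
Qed.

Lemma truncated_square_small (e : R) : 0 < e ->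
  exists k : nat, \int[P2]_w truncated_square (Y' w / k.+1%:R) < e.
Proof.
apply: (@Rintegral_vanishing _ _ _ P2 _ mY' (fun k x => truncated_square (x / k.+1%:R))).
- move=> k; apply: measurableT_comp; first by have [] := @bm_truncated_square R.
  by apply: measurable_funM; [exact: measurable_id|exact: measurable_cst].
- by move=> k x; exact: truncated_square01.
- move=> x; have -> : 0 = truncated_square (0 : R).
    by rewrite /truncated_square expr0n mul0r.
  apply: continuous_cvg; first exact: continuous_truncated_square.
  by rewrite -(mulr0 x); apply: cvgMr; exact: cvg_harmonic.
Qed.

Theorem levy_continuity : cvg_in_distribution P1 P2 Y Y'.
Proof.
apply/cvg_in_distributionP => // f cf bf.
have bmf := bm_continuous cf (proj1 (bounded_funP _) bf).
have [M M0 fM] := bounded_fun_gt0 bf.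
apply: (@converges_on_approx _ _ _ _ _ _ _ _ _ mY mY' setT) => // e e0.
(* The error function below carries the factor [8 * M], which turns this into [e / 2]. *)
have [k ke] := @truncated_square_small (e / (16 * M)) (divr_gt0 e0 (mulr_gt0 (ltr0n R 16) M0)).
pose K : R := k.+1%:R; have K0 : 0 < K by rewrite ltr0n.
(* With this frequency, |x| <= K is exactly the range where c x lies in [- pi / 2, pi / 2], on which
   [asin] inverts the sine. *)
pose c : R := pi / (2 * K).
have c0 : 0 < c by rewrite divr_gt0 ?pi_gt0 ?mulr_gt0.
pose a (s : R) := f (asin s / c).
(* At s = sin(c x) this is |cos(c x)|. As [Num.sqrt] is 0 on negative numbers, [w] vanishes off the
   open interval ]-1, 1[ where [asin] is known to be continuous. *)
pose w (s : R) := Num.sqrt (1 - s ^+ 2).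
have cw : continuous w.
  move=> s; apply: continuous_comp; last exact: sqrt_continuous.
  by apply: cvgB; [exact: cvg_cst|exact: exprn_continuous].
have caw : continuous (fun s => a s * w s).
  apply: (@continuousM_bounded _ _ _ M) => [//|s|s]; first exact: fM.
  rewrite /w sqrtr_eq0 -ltNge => s1.
  apply: continuous_comp; last exact: cf.
  apply: cvgMl; apply: continuous_asin.
  by apply/andP; split; nra.
have caww : continuous (fun s => a s * w s * w s).
  by move=> s; apply: cvgM; [exact: caw|exact: cw].
have aff (g : R -> R) : continuous g -> continuous (fun v : R => g (2 * v - 1)).
  move=> cg v; apply: continuous_comp; last exact: cg.
  by apply: cvgB; [apply: cvgMr; exact: cvg_id|exact: cvg_cst].
have e20 : 0 < e / 2 by rewrite divr_gt0.
have [p pG] := weierstrass01 (aff _ caww) e20.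
have [q qH] := weierstrass01 (aff _ caw) e20.
pose v (x : R) : R := (1 + sin (c * x)) / 2.
exists (fun x => 1 / 2 * (1 * p.[v x]) + 1 / 2 * (cos (c * x) * q.[v x])).
exists (fun x => 8 * M * truncated_square (x / K) + e / 2); split.
- apply: converges_onD => //; apply: converges_onZ => //; apply: converges_on_poly => // j.
    by have := converges_on_cos_sinX c j 0 0; under eq_fun do rewrite mul0r addr0 cos0.
  by have := converges_on_cos_sinX c j c 0; under eq_fun do rewrite addr0.
- apply: converges_onD => //; last exact: converges_on_cst.
  by apply: converges_onZ => //; exact: truncated_square_cvg.
- move=> x _.
  set s := sin (c * x); set C := cos (c * x).
  have v01 : 0 <= v x <= 1.
    have := sin_geN1 (c * x); have := sin_le1 (c * x); rewrite /v => ? ?.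
    by apply/andP; split; lra.
  have vE : 2 * v x - 1 = s by rewrite /v -/s; field.
  have := pG _ v01; have := qH _ v01; rewrite vE => qs ps.
  have C1 : `|C| <= 1 by exact: cos_max.
  have wC : w s = `|C| by rewrite /w /s -cos2sin2 sqrtr_sqr.
  have {}qs : `|C * (a s * w s - q.[v x])| <= e / 2.
    by rewrite normrM (le_trans _ qs)// ler_piMl.
  (* Here (w + C) / 2 is the positive part of C, so [fper] is periodic, equals f(x) C^2 when |x| <=
     K, and vanishes where the cosine is negative, which removes the mirror image. Expanded, it is a
     function of the sine plus C times another one. *)
  pose fper := (a s * w s * w s + C * (a s * w s)) / 2.
  have main : `|f x - fper| <= 8 * M * truncated_square (x / K).
    have tsq0 := truncated_square01 (x / K).
    have [xK|xK] := leP `|x / K| 1.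
    + have th : - (pi / 2) <= c * x <= pi / 2.
        rewrite (_ : c * x = pi / 2 * (x / K)); last by rewrite /c; field; rewrite gt_eqF.
        have p0 : 0 < pi / 2 :> R by rewrite divr_gt0 ?pi_gt0.
        move: xK; rewrite ler_norml => /andP[? ?].
        by rewrite -(mulrN1 (pi / 2)) ler_pM2l// ler_piMr ?(ltW p0)// andbT.
      have Cge0 : 0 <= C by exact: cos_ge0_pihalf.
      have aE : a s = f x.
        by rewrite /a /s sinK ?in_itv//= mulrAC divff ?gt_eqF// mul1r.
      have -> : f x - fper = f x * s ^+ 2.
        by rewrite /fper wC (ger0_norm Cge0) aE /s sin2cos2 -/C; field.
      rewrite normrM (@ger0_norm _ (s ^+ 2)) ?sqr_ge0//.
      (* Since pi / 2 < 2. Passing from (x / K)^2 to the truncated square costs a further factor 2,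
         whence the 8. *)
      have s2 : s ^+ 2 <= 4 * (x / K) ^+ 2.
        rewrite (le_trans (sqr_sin_le _))//.
        rewrite (_ : c * x = pi / 2 * (x / K)); last by rewrite /c; field; rewrite gt_eqF.
        rewrite exprMn ler_wpM2r ?sqr_ge0//.
        have p0 : 0 < pi / 2 :> R by rewrite divr_gt0 ?pi_gt0.
        by have := @pihalf_lt2 R; nra.
      have := truncated_square_ge xK => ts.
      have := fM x; have := normr_ge0 (f x); have := sqr_ge0 s => ? ? ?.
      apply: (@le_trans _ _ (M * s ^+ 2)); first by rewrite ler_wpM2r.
      rewrite (_ : 8 * M * _ = M * (8 * truncated_square (x / K))); last by ring.
      rewrite ler_wpM2l ?(ltW M0)//.
      by move: s2 ts; set y2 := (x / K) ^+ 2; set t := truncated_square _; lra.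
    + have ts := truncated_square_ge_half (ltW xK).
      have fperM : `|fper| <= M.
        rewrite /fper (_ : _ / 2 = a s * (w s * ((w s + C) / 2))); last by field.
        rewrite normrM -[leRHS]mulr1 ler_pM//; first exact: fM.
        rewrite normrM -[leRHS]mulr1 ler_pM//; first by rewrite wC normr_id.
        have := ler_norm C; have := ler_norm (- C); rewrite normrN => ? ?.
        by rewrite wC ler_norml; apply/andP; split; lra.
      apply: (@le_trans _ _ (2 * M)).
        by rewrite (le_trans (ler_normB _ _))// mulr_natl mulr2n lerD// fM.
      have : M * (1 / 2) <= M * truncated_square (x / K) by rewrite ler_wpM2l ?(ltW M0).
      lra.
  move: main ps qs; rewrite !ler_norml /fper => /andP[? ?] /andP[? ?] /andP[? ?].
  by apply/andP; split; lra.
- have bts := converges_onZ mY mY' (8 * M) (truncated_square_cvg K).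
  have b8 : bounded_measurable (fun x => 8 * M * truncated_square (Y' x / K)).
    by have [b _] := bts; exact: (bm_comp b mY').
  rewrite bm_RintegralD//; last exact: bmcst.
  rewrite Rintegral_probability_cst.
  rewrite bm_RintegralZ; last first.
    by have [b _] := truncated_square_cvg K; exact: (bm_comp b mY').
  have : 8 * M * (\int[P2]_x truncated_square (Y' x / K)) <= 8 * M * (e / (16 * M)).
    by rewrite ler_wpM2l ?mulr_ge0 ?ltW.
  by rewrite (_ : 8 * M * (e / _) = e / 2); [lra|field; rewrite gt_eqF].
Qed.

End levy_continuity.

(** * Independence and sums *)

Section independence.
Context d (T : measurableType d) (R : realType) (P : probability T R).

(** The joint law and the product of the laws agree on rectangles, hence everywhere, and Fubini's
    theorem factors the integral. *)
Lemma independent_Rintegral d1 d2 (T1 : measurableType d1) (T2 : measurableType d2)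
    (X : {RV P >-> T1}) (Y : {RV P >-> T2}) (g : T1 -> R) (h : T2 -> R) :
  (forall A B, measurable A -> measurable B ->
    P (X @^-1` A `&` Y @^-1` B) = (P (X @^-1` A) * P (Y @^-1` B))%E) ->
  bounded_measurable g -> bounded_measurable h ->
  \int[P]_w (g (X w) * h (Y w)) = \int[P]_w g (X w) * \int[P]_w h (Y w).
Proof.
move=> XY bg bh.
have mXY : measurable_fun setT (fun w => (X w, Y w)) by exact: measurable_fun_pair.
pose XY_ : {RV P >-> (T1 * T2)%type} := mfun_Sub (mem_set mXY).
pose k (z : T1 * T2) := g z.1 * h z.2.
have bk : bounded_measurable k.
  by apply: bmM; [exact: (bm_comp bg measurable_fst)|exact: (bm_comp bh measurable_snd)].
have law A : measurable A ->
    (distribution P X \x distribution P Y)%E A = distribution P XY_ A.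
  by move=> mA; apply: product_measure_unique => // B C mB mC; exact: XY.
have law_int : (\int[distribution P X \x distribution P Y]_z (k z)%:E =
    \int[distribution P XY_]_z (k z)%:E)%E.
  by apply: eq_measure_integral => A mA _; exact: law.
have intk : (distribution P X \x distribution P Y)%E.-integrable setT (EFin \o k).
  have [mk fk] := bk; apply: measurable_bounded_integrable => //; last exact/bounded_funP.
  by rewrite [X in (X < _)%E](law setT measurableT) [X in (X < _)%E]probability_setT ltry.
have lhs : (\int[P]_w (g (X w) * h (Y w)))%:E =
    (\int[distribution P XY_]_z (k z)%:E)%E.
  rewrite integral_distribution/=.
  - by rewrite -(bm_expectation P (bm_comp bk mXY)) unlock.
  - by apply/measurable_EFinP; have [] := bk.
  - exact: (bm_integrable P (bm_comp bk mXY)).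
have marg d' (T' : measurableType d') (V : {RV P >-> T'}) (f : T' -> R) :
    bounded_measurable f ->
    (\int[distribution P V]_y (f y)%:E = (\int[P]_w f (V w))%:E)%E.
  move=> bf; have bfV : bounded_measurable (f \o V) by exact: bm_comp.
  rewrite integral_distribution/=.
  - by rewrite -(bm_expectation P bfV) unlock.
  - by apply/measurable_EFinP; have [] := bf.
  - exact: bm_integrable.
apply: EFin_inj; rewrite lhs -law_int -(integral12_prod_meas1 intk) /fubini_F.
rewrite EFinM -(marg _ _ X)//.
under eq_integral => x _.
  rewrite /k/=; under eq_integral do rewrite EFinM.
  rewrite integralZl//; last exact: bm_integrable.
  rewrite (marg _ _ Y)//.
  over.
by rewrite integralZr//; exact: bm_integrable.
Qed.

(** The sum is measured on [T] equipped with [<<s G >>]. The generator is left free: it is a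
    pi-system of finite intersections in one use, and the generator of [sigma_of_sequence X] in the
    other. *)
Lemma partial_sum_preimage (G : set (set T)) (X : nat -> T -> R) (k : nat) :
  (forall i, (i < k)%N -> forall B, measurable B -> <<s G >> (X i @^-1` B)) ->
  forall B, measurable B -> <<s G >> (partial_sum X k @^-1` B).
Proof.
move=> GX B mB.
have mS : measurable_fun setT
    (fun w : g_sigma_algebraType G => \sum_(i < k) X i w).
  by apply: measurable_sum => i _ A mA; rewrite setTI; exact: GX.
by have := mS measurableT B mB; rewrite setTI.
Qed.

Lemma mutually_independent_partial_sum (X : nat -> {RV P >-> R}) k A B :
  mutually_independent P (fun i => g_sigma_algebra_preimage (X i)) ->
  measurable A -> measurable B ->
  P (partial_sum X k @^-1` A `&` X k @^-1` B) =
  (P (partial_sum X k @^-1` A) * P (X k @^-1` B))%E.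
Proof.
move=> indX mA mB.
pose F := X k @^-1` B.
have mF : measurable F by exact: measurable_funPTI.
(* A pi-system generating the events of the first [k] variables. The measures E |-> P(E and F) and E
   |-> P(E) P(F) agree on it, hence on the events of the partial sum. *)
pose G : set (set T) := [set E | exists2 C : nat -> set T,
  forall i, g_sigma_algebra_preimage (X i) (C i) & E = \bigcap_(i in `I_k) C i].
have sX i C : g_sigma_algebra_preimage (X i) C -> measurable C.
  by move=> [D mD <-]; rewrite setTI; exact: measurable_funPTI.
have GT : G setT.
  exists (fun=> setT); last by rewrite bigcapT.
  by move=> i; exists setT => //; rewrite setTI preimage_setT.
have prodG (C : nat -> set T) n : (forall i, g_sigma_algebra_preimage (X i) (C i)) ->
    P (\bigcap_(i in `I_n) C i) = (\prod_(i < n) P (C i))%E.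
  move=> XC.
  have := indX [fset i | i in iota 0 n]%fset C (fun i _ => XC i).
  rewrite big_imfset//=.
  rewrite undup_id ?iota_uniq//.
  have -> : (\prod_(i <- iota 0 n) P (C i) = \prod_(i < n) P (C i))%E.
    by rewrite -(big_mkord xpredT (fun i => P (C i))) /index_iota subn0.
  move=> <-.
  congr (P _); apply/seteqP; split=> w Cw i /= i_n; apply: Cw => /=; move: i_n;
    by rewrite !inE/= mem_iota add0n.
have FG E : G E -> P (E `&` F) = (P E * P F)%E.
  move=> [C XC ->].
  (* Adding F as the event of index [k] makes E and F together one finite intersection, to which
     mutual independence applies. *)
  pose C' i := if i == k then F else C i.
  have XC' i : g_sigma_algebra_preimage (X i) (C' i).
    rewrite /C'; case: eqP => [->|_]; last exact: XC.
    by exists B => //; rewrite setTI.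
  have CC' i : (i < k)%N -> C' i = C i by rewrite /C'; case: ltngtP.
  have := prodG C' k.+1 XC'; rewrite big_ord_recr/= {3}/C' eqxx.
  rewrite (eq_bigr (fun i : 'I_k => P (C i))); last by move=> i _; rewrite CC'.
  rewrite -prodG// => <-; congr (P _); apply/seteqP; split.
  - move=> w [Cw Fw] i /=; rewrite ltnS leq_eqVlt => /predU1P[->|ik].
      by rewrite /C' eqxx.
    by rewrite CC'//; exact: Cw.
  - move=> w Cw; split.
      by move=> i /= ik; rewrite -CC'//; apply: Cw; rewrite /= ltnS ltnW.
    by have := Cw k (ltnSn k); rewrite /C' eqxx.
have PF0 : 0 <= fine (P F) by rewrite fine_ge0.
have scaleE E : mscale (NngNum PF0) P E = (P E * P F)%E.
  by rewrite /mscale/= fineK ?fin_num_measure// muleC.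
rewrite -[LHS]/(mrestr P mF (partial_sum X k @^-1` A)) -scaleE.
apply: (@g_sigma_algebra_measure_unique _ _ _ G _ (fun=> setT)).
- move=> _ [C XC ->]; apply: bigcap_measurableType => // i _; exact: sX (XC i).
- by [].
- by rewrite bigcup_const//; exists 0%N.
- move=> _ _ [C XC ->] [D XD ->]; exists (fun i => C i `&` D i).
    move=> i; have [C' mC' <-] := XC i; have [D' mD' <-] := XD i.
    by exists (C' `&` D'); [exact: measurableI|rewrite !setTI preimage_setI].
  by rewrite bigcapI.
- by move=> E GE; exact: (etrans (FG _ GE) (esym (scaleE E))).
- by move=> _; rewrite /= /mrestr setTI (le_lt_trans (probability_le1 _ _)) ?ltry.
- apply: partial_sum_preimage => // i ik D mD; apply: sub_sigma_algebra.
  exists (fun j => if j == i then X i @^-1` D else setT).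
    move=> j; case: eqP => [->|_]; first by exists D => //; rewrite setTI.
    by exists setT => //; rewrite setTI preimage_setT.
  apply/seteqP; split=> w.
    by move=> Xw j /= jk; case: eqP.
  by move=> /(_ i ik); rewrite eqxx.
Qed.

End independence.

Section characteristic_function_of_sums.
Context d (T : measurableType d) (R : realType) (P : probability T R)
  (X : nat -> {RV P >-> R}).
Implicit Types (u : R) (k : nat).

Lemma measurable_partial_sum k : measurable_fun setT (partial_sum X k).
Proof. by apply: measurable_sum => i; exact: measurable_funP. Qed.

Lemma partial_sumS k w : partial_sum X k.+1 w = partial_sum X k w + X k w.
Proof. by rewrite /partial_sum big_ord_recr. Qed.

Context (iidX : iid X).

Lemma iid_Rintegral k (g : R -> R) : bounded_measurable g ->
  \int[P]_w g (X k w) = \int[P]_w g (X 0%N w).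
Proof.
move=> bg.
have E i : (\int[P]_w (g (X i w))%:E = \int[distribution P (X i)]_x (g x)%:E)%E.
  rewrite integral_distribution//; first by apply/measurable_EFinP; have [] := bg.
  by apply: bm_integrable; exact: bm_comp.
rewrite /Rintegral !E; congr fine; apply: eq_measure_integral => A mA _.
exact: (proj2 iidX).
Qed.

Lemma Rintegral_partial_sumM k (g h : R -> R) :
  bounded_measurable g -> bounded_measurable h ->
  \int[P]_w (g (partial_sum X k w) * h (X k w)) =
  \int[P]_w g (partial_sum X k w) * \int[P]_w h (X 0%N w).
Proof.
move=> bg bh; rewrite -(iid_Rintegral k bh).
pose S : {RV P >-> R} := mfun_Sub (mem_set (measurable_partial_sum k)).
apply: (@independent_Rintegral _ _ _ _ _ _ _ _ S (X k)) => // A B mA mB.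
have [indX _] := iidX.
exact: (@mutually_independent_partial_sum _ _ _ P X k A B indX mA mB).
Qed.

Let a u := \int[P]_w cos (u * X 0%N w).
Let b u := \int[P]_w sin (u * X 0%N w).
Let c u k := \int[P]_w cos (u * partial_sum X k w).
Let s u k := \int[P]_w sin (u * partial_sum X k w).

Let bSX k (g h : R -> R) : bounded_measurable g -> bounded_measurable h ->
  bounded_measurable (fun w => g (partial_sum X k w) * h (X k w)).
Proof.
move=> bg bh; apply: bmM; last exact: bm_comp.
by apply: bm_comp => //; exact: measurable_partial_sum.
Qed.

(** Real part of phi^(k+1) = phi^k phi, where phi = a + i b and phi^k = c + i s; [sin_partial_sumS]
    is the imaginary part. *)
Lemma cos_partial_sumS u k : c u k.+1 = c u k * a u - s u k * b u.
Proof.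
have := Rintegral_partial_sumM k (bm_cosM u) (bm_cosM u); rewrite -/(c u k) -/(a u) => <-.
have := Rintegral_partial_sumM k (bm_sinM u) (bm_sinM u); rewrite -/(s u k) -/(b u) => <-.
rewrite -bm_RintegralB; [|exact: (bSX k (bm_cosM u) (bm_cosM u))
  |exact: (bSX k (bm_sinM u) (bm_sinM u))].
by apply: eq_Rintegral => w _; rewrite partial_sumS mulrDr cosD.
Qed.

Lemma sin_partial_sumS u k : s u k.+1 = s u k * a u + c u k * b u.
Proof.
have := Rintegral_partial_sumM k (bm_sinM u) (bm_cosM u); rewrite -/(s u k) -/(a u) => <-.
have := Rintegral_partial_sumM k (bm_cosM u) (bm_sinM u); rewrite -/(c u k) -/(b u) => <-.
rewrite -bm_RintegralD; [|exact: (bSX k (bm_sinM u) (bm_cosM u))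
  |exact: (bSX k (bm_cosM u) (bm_sinM u))].
by apply: eq_Rintegral => w _; rewrite partial_sumS mulrDr sinD.
Qed.

(* With phi = a + i b, writing phi^(k+1) - q^(k+1) = q (phi^k - q^k) + (phi - q) phi^k
   gives the bound |phi - q| / (1 - q), uniformly in k. *)
Lemma partial_sum_geometric_bound u q k : 0 <= q < 1 ->
  let D := (`|a u - q| + `|b u|) / (1 - q) in
  `|c u k - q ^+ k| <= D /\ `|s u k| <= D.
Proof.
move=> /andP[q0 q1] D.
have q10 : 0 < 1 - q by rewrite subr_gt0.
(* [D] is the fixed point of the error recursion, so the induction returns the same bound at every
   [k]. *)
have DE : q * D + (`|a u - q| + `|b u|) = D by rewrite /D; field; rewrite gt_eqF.
have D0 : 0 <= D by apply: divr_ge0; [exact: addr_ge0|exact: ltW].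
have c1 j : `|c u j| <= 1.
  apply: norm_Rintegral_le1 => [|w]; last exact: cos_max.
  exact: (bm_comp (bm_cosM u) (measurable_partial_sum j)).
have s1 j : `|s u j| <= 1.
  apply: norm_Rintegral_le1 => [|w]; last exact: sin_max.
  exact: (bm_comp (bm_sinM u) (measurable_partial_sum j)).
have step (x y z : R) : `|x| <= D -> `|y| <= 1 -> `|z| <= 1 ->
    `|q * x + (a u - q) * y + z * b u| <= D.
  move=> xD y1 z1; rewrite -DE -addrA (le_trans (ler_normD _ _))// lerD//.
    by rewrite normrM ger0_norm// ler_wpM2l.
  rewrite (le_trans (ler_normD _ _))// lerD// normrM.
    by rewrite ler_piMr.
  by rewrite ler_piMl.
elim: k => [|k [ihc ihs]].
  rewrite /c /s /partial_sum.
  under eq_Rintegral do rewrite big_ord0 mulr0 cos0.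
  rewrite Rintegral_probability_cst expr0 subrr normr0; split => //.
  under eq_Rintegral do rewrite big_ord0 mulr0 sin0.
  by rewrite Rintegral_probability_cst normr0.
split.
- rewrite cos_partial_sumS (_ : _ - _ = q * (c u k - q ^+ k) + (a u - q) * c u k +
    (- s u k) * b u); last by rewrite exprS; ring.
  by apply: step; rewrite ?normrN.
- rewrite sin_partial_sumS (_ : _ + _ = q * s u k + (a u - q) * s u k +
    c u k * b u); last by ring.
  exact: step.
Qed.

End characteristic_function_of_sums.

(** * Averaging over an independent number of summands *)

Section random_sum_expectation.
Context d (T : measurableType d) (R : realType) (P : probability T R)
  (X : nat -> {RV P >-> R}) (N : {RV P >-> nat}).

Let N_eq k := N @^-1` [set k].

Let mN k : measurable (N_eq k).
Proof. exact: measurable_funPTI. Qed.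

Let N_cover : \bigcup_k N_eq k = setT.
Proof. by apply/seteqP; split=> // w _; exists (N w). Qed.

Let N_triv : trivIset setT N_eq.
Proof.
apply/trivIsetP => i j _ _ /eqP ij; rewrite -subset0 => w [Ni Nj].
by apply: ij; rewrite -(Ni : N w = i) -(Nj : N w = j).
Qed.

Lemma measurable_random_sum : measurable_fun setT (random_sum X N).
Proof.
move=> _ B mB; rewrite setTI.
rewrite (_ : _ @^-1` _ = \bigcup_k (N_eq k `&` partial_sum X k @^-1` B)).
  apply: bigcupT_measurable => k; apply: measurableI => //.
  by have := measurable_partial_sum X k measurableT mB; rewrite setTI.
apply/seteqP; split=> [w Bw|w [k _ [Nk Bk]]]; first by exists (N w).
by rewrite /= /random_sum (Nk : N w = k).
Qed.

Context (indep : independent P (g_sigma_algebra_preimage N) (sigma_of_sequence X)).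

(** On the event that N equals k the random sum has fixed length, and independence factors the
    expectation. Nonnegativity lets the integral be summed over these countably many events. *)
Let ge0_random_sum_expectation (h : R -> R) :
  bounded_measurable h -> (forall x, 0 <= h x) ->
  \int[P]_w h (random_sum X N w) = \int[P]_w (\int[P]_w' h (partial_sum X (N w) w')).
Proof.
move=> bh h0; have [mh _] := bh.
pose C k := \int[P]_w' h (partial_sum X k w').
rewrite -[RHS]/(\int[P]_w C (N w)) /Rintegral; congr fine.
rewrite -[in LHS]N_cover -[in RHS]N_cover.
rewrite !ge0_integral_bigcup//; first last.
- by move=> w _; rewrite lee_fin.
- rewrite N_cover; apply/measurable_EFinP.
  exact: (measurableT_comp mh measurable_random_sum).
- by move=> w _; rewrite lee_fin Rintegral_ge0.
- rewrite N_cover; apply/measurable_EFinP.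
  exact: (@measurableT_comp _ _ _ _ _ _ C).
apply: eq_eseriesr => k _.
pose g (m : nat) : R := (m == k)%:R.
have bg : bounded_measurable g.
  by split => //; exists 1 => m; rewrite /g; case: eqP; rewrite ?normr1 ?normr0.
pose S : {RV P >-> R} := mfun_Sub (mem_set (measurable_partial_sum X k)).
have gS := @independent_Rintegral _ _ _ P _ _ _ _ N S g h _ bg bh.
have bhS : bounded_measurable (h \o S) by exact: bm_comp.
have {}gS : \int[P]_w (g (N w) * h (S w)) = \int[P]_w g (N w) * \int[P]_w h (S w).
  apply: gS => A B mA mB; apply: indep.
    by exists A => //; rewrite setTI.
  apply: partial_sum_preimage => // i _ D mD; apply: sub_sigma_algebra.
  by exists i => //; exists D => //; rewrite setTI.
have gE (f : T -> R) : bounded_measurable f ->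
    (\int[P]_(w in N_eq k) (f w)%:E = (\int[P]_w (g (N w) * f w))%:E)%E.
  move=> bf; rewrite -(bm_expectation P (bmM (bm_comp bg _) bf)) ?unlock// integral_mkcond.
  apply: eq_integral => w _; rewrite patchE /= /g.
  have [Nw|Nw] := eqVneq (N w) k.
    by rewrite mem_set// mul1r.
  by rewrite memNset ?mul0r// => /eqP; rewrite (negbTE Nw).
transitivity (\int[P]_(w in N_eq k) (h (S w))%:E)%E.
  by apply: eq_integral => w; rewrite inE => /= Nw; rewrite /random_sum Nw.
rewrite (gE _ bhS) gS.
transitivity (\int[P]_(w in N_eq k) (C k)%:E)%E; last first.
  by apply: eq_integral => w; rewrite inE => /= ->.
rewrite (gE _ (bmcst _ _)) mulrC -bm_RintegralZ; last exact: bm_comp.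
by congr EFin; apply: eq_Rintegral => w _; rewrite mulrC.
Qed.

Lemma random_sum_expectation (h : R -> R) : bounded_measurable h ->
  \int[P]_w h (random_sum X N w) = \int[P]_w (\int[P]_w' h (partial_sum X (N w) w')).
Proof.
move=> bh; have [mh [M hM]] := bh.
(* Adding the bound [M] makes the function nonnegative, and the constant cancels afterwards. *)
have bhM : bounded_measurable (fun x => h x + M) by apply: bmD => //; exact: bmcst.
have hM0 x : 0 <= h x + M by have := hM x; rewrite ler_norml => /andP[]; lra.
have := ge0_random_sum_expectation bhM hM0.
have bS k : bounded_measurable (h \o partial_sum X k).
  by apply: bm_comp => //; exact: measurable_partial_sum.
have E k : \int[P]_w (h (partial_sum X k w) + M) = \int[P]_w h (partial_sum X k w) + M.
  rewrite bm_RintegralD; [|exact: bS|exact: bmcst].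
  by rewrite Rintegral_probability_cst.
under [X in _ = X -> _]eq_Rintegral do rewrite E.
rewrite bm_RintegralD; [|exact: (bm_comp bh measurable_random_sum)|exact: bmcst].
rewrite bm_RintegralD; [|split|exact: bmcst].
- by move=> /addIr.
- by apply: (@measurableT_comp _ _ _ _ _ _ (fun k => \int[P]_w' h (partial_sum X k w'))).
- exists (`|M|) => w; rewrite (le_trans (le_normr_Rintegral _ _))//.
    by apply: bm_integrable; exact: bS.
  rewrite -[leRHS](Rintegral_probability_cst P).
  apply: bm_le_Rintegral; [exact: bm_norm (bS _)|exact: bmcst|].
  by move=> w'; rewrite (le_trans (hM _))// ler_norm.
Qed.

End random_sum_expectation.

(** * Second order expansion of the characteristic function *)

Lemma cvg0_le_norm (R : realType) (f g : nat -> R) :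
  (forall n, `|f n| <= g n) -> g n @[n --> \oo] --> 0 -> f n @[n --> \oo] --> 0.
Proof.
move=> fg g0; apply/norm_cvg0P; apply: (squeeze_cvgr _ (cvg_cst 0) g0).
by apply: nearW => n; rewrite normr_ge0 fg.
Qed.

Section second_order_expansion.
Context d (T : measurableType d) (R : realType) (P : probability T R)
  (X : {RV P >-> R}) (sigma : R) (sigma0 : 0 < sigma)
  (X_mean : ('E_P[X] = 0)%E) (X_var : ('V_P[X] = (sigma ^+ 2)%:E)%E).

Let mX : measurable_fun setT X.
Proof. exact: measurable_funP. Qed.

Let integral_sqr : (\int[P]_w (X w ^+ 2)%:E = (sigma ^+ 2)%:E)%E.
Proof.
rewrite -X_var /variance unlock X_mean/= unlock; apply: eq_integral => w _.
by congr EFin; rewrite expr2 -[RHS]/((X w - 0) * (X w - 0)) subr0.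
Qed.

Lemma integrable_sqr : P.-integrable setT (EFin \o (fun w => X w ^+ 2)).
Proof.
apply/integrableP; split; first by apply/measurable_EFinP; exact: measurable_funX.
under eq_integral do rewrite /= ger0_norm ?sqr_ge0//.
by rewrite integral_sqr ltry.
Qed.

Lemma Rintegral_sqr : \int[P]_w (X w ^+ 2) = sigma ^+ 2.
Proof. by rewrite /Rintegral integral_sqr. Qed.

Lemma integrable_of_sqr : P.-integrable setT (EFin \o X).
Proof.
have i1 : P.-integrable setT (EFin \o (fun w => 1 + X w ^+ 2)).
  rewrite [Z in integrable _ _ Z](_ : _ =
    (fun w => 1%:E + (X w ^+ 2)%:E)%E) //.
  apply: integrableD => //; last exact: integrable_sqr.
  by apply: bm_integrable; exact: bmcst.
apply: le_integrable i1 => //; first exact/measurable_EFinP.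
move=> w _; rewrite /= lee_fin [leRHS]ger0_norm ?addr_ge0 ?sqr_ge0//.
rewrite -(real_normK (num_real (X w))).
by have := sqr_ge0 (`|X w| - 1); have := normr_ge0 (X w); nra.
Qed.

Lemma Rintegral_mean : \int[P]_w X w = 0.
Proof. by have := X_mean; rewrite unlock /Rintegral => ->. Qed.

Context (t : R).
(** Indices are shifted by one, so that [n.+1] is the rank in the sequence and no normalization is
    by zero. *)
Let r (n : nat) : R := (Num.sqrt n.+1%:R)^-1.
Let u (n : nat) : R := t / (sigma * Num.sqrt n.+1%:R).
Let N (n : nat) : R := n.+1%:R.
Let v (n : nat) : R := t ^+ 2 / 2 / n.+1%:R.

Let N0 n : 0 < N n. Proof. by rewrite ltr0n. Qed.

Let r2 n : r n ^+ 2 = (N n)^-1.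
Proof. by rewrite exprVn sqr_sqrtr// ltW. Qed.

Let r_ge0 n : 0 <= r n.
Proof. by rewrite invr_ge0 sqrtr_ge0. Qed.

Let uE n : u n = t / sigma * r n.
Proof. by rewrite /u /r invfM mulrA. Qed.

Let Nu2 n : N n * u n ^+ 2 = (t / sigma) ^+ 2.
Proof. by rewrite uE exprMn r2; field; rewrite ?gt_eqF. Qed.

Let cvg_r : r n @[n --> \oo] --> 0.
Proof.
rewrite -[X in _ --> X](@sqrtr0 R).
rewrite (_ : r = Num.sqrt \o (fun n => n.+1%:R^-1)).
  by apply: continuous_cvg; [exact: sqrt_continuous|exact: cvg_harmonic].
by apply/funext => n; rewrite /= sqrtrV.
Qed.

Let cvg_VN : (N n)^-1 @[n --> \oo] --> 0.
Proof. exact: cvg_harmonic. Qed.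

Let int_dom (c : R) : P.-integrable setT (EFin \o (fun w => c * X w ^+ 2)).
Proof.
rewrite [Z in integrable _ _ Z](_ : _ =
  (fun w => c%:E * (X w ^+ 2)%:E)%E) //.
by apply: integrableZl => //; exact: integrable_sqr.
Qed.

(** As X has second moment sigma^2, the quadratic Taylor term integrates exactly to [v n]. The
    rescaled remainder is O(1 / N) at each point and dominated by a multiple of X^2. *)
Lemma cos_expansion_cvg0 :
  N n * (\int[P]_w cos (u n * X w) - (1 - v n)) @[n --> \oo] --> 0.
Proof.
pose f n w := N n * (cos (u n * X w) - (1 - (u n * X w) ^+ 2 / 2)).
have bc n : bounded_measurable (fun w => cos (u n * X w)).
  exact: (bm_comp (bm_cosM (u n)) mX).
have fE n : N n * (\int[P]_w cos (u n * X w) - (1 - v n)) = \int[P]_w f n w.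
  rewrite /f.
  rewrite [RHS](@eq_Rintegral _ _ _ P setT
    (fun w => (N n * cos (u n * X w) - N n) + (N n * u n ^+ 2 / 2) * X w ^+ 2)); last first.
    by move=> w _; field.
  have b1 : bounded_measurable (fun w => N n * cos (u n * X w) - N n).
    by apply: bmB; [exact: bmZ|exact: bmcst].
  rewrite RintegralD//; last exact: bm_integrable.
  rewrite bm_RintegralB; [|exact: bmZ|exact: bmcst].
  rewrite bm_RintegralZ// Rintegral_probability_cst RintegralZl//; last exact: integrable_sqr.
  rewrite Rintegral_sqr Nu2 /v; field.
  by rewrite !gt_eqF.
under eq_fun do rewrite fE.
rewrite -(Rintegral_probability_cst P 0).
apply: (@Rintegral_dominated_cvg _ _ _ P f (fun=> 0)
  (fun w => ((t / sigma) ^+ 2 / 2) * X w ^+ 2)) => //.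
- move=> n; apply: measurable_funM; first exact: measurable_cst.
  apply: measurable_funB; first by have [] := bc n.
  apply: measurable_funB; first exact: measurable_cst.
  apply: measurable_funM; last exact: measurable_cst.
  by apply: measurable_funX; apply: measurable_funM => //; exact: measurable_cst.
- move=> w; apply: (@cvg0_le_norm _ _ (fun n => ((t / sigma * X w) ^+ 4 / 24) * (N n)^-1)).
    move=> n; rewrite /f normrM (gtr0_norm (N0 n)).
    rewrite (le_trans (ler_wpM2l (ltW (N0 n)) (cos_taylor_bound4 _)))//.
    rewrite uE (_ : _ / 24 = (t / sigma * X w) ^+ 4 / 24 * (r n ^+ 2) ^+ 2); last first.
      by field; rewrite gt_eqF.
    by rewrite r2 le_eqVlt; apply/orP; left; apply/eqP; field; rewrite !gt_eqF.
  by rewrite -(mulr0 ((t / sigma * X w) ^+ 4 / 24)); apply: cvgMr.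
- move=> n w; rewrite /f normrM (gtr0_norm (N0 n)).
  rewrite (le_trans (ler_wpM2l (ltW (N0 n)) (cos_taylor_bound2 _)))//.
  by rewrite -(Nu2 n) le_eqVlt; apply/orP; left; apply/eqP; field.
- by move=> w; rewrite normr0 mulr_ge0 ?divr_ge0 ?sqr_ge0.
Qed.

(** The linear Taylor term has zero expectation and can be subtracted freely; the remainder is then
    treated as for the cosine. *)
Lemma sin_expansion_cvg0 :
  N n * \int[P]_w sin (u n * X w) @[n --> \oo] --> 0.
Proof.
pose f n w := N n * (sin (u n * X w) - u n * X w).
have bs n : bounded_measurable (fun w => sin (u n * X w)).
  exact: (bm_comp (bm_sinM (u n)) mX).
have fE n : N n * \int[P]_w sin (u n * X w) = \int[P]_w f n w.
  rewrite /f.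
  rewrite [RHS](@eq_Rintegral _ _ _ P setT
    (fun w => N n * sin (u n * X w) + (- (N n * u n)) * X w)); last first.
    by move=> w _; ring.
  have iX := integrable_of_sqr.
  rewrite RintegralD//; last 2 first.
  - by apply: bm_integrable; exact: bmZ.
  - rewrite [Z in integrable _ _ Z](_ : _ =
      (fun w => (- (N n * u n))%:E * (X w)%:E)%E) //.
    exact: integrableZl.
  by rewrite bm_RintegralZ// RintegralZl// Rintegral_mean mulr0 addr0.
under eq_fun do rewrite fE.
rewrite -(Rintegral_probability_cst P 0).
apply: (@Rintegral_dominated_cvg _ _ _ P f (fun=> 0)
  (fun w => (2 * (t / sigma) ^+ 2) * X w ^+ 2)) => //.
- move=> n; apply: measurable_funM; first exact: measurable_cst.
  apply: measurable_funB; first by have [] := bs n.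
  by apply: measurable_funM => //; exact: measurable_cst.
- move=> w; apply: (@cvg0_le_norm _ _ (fun n => (`|t / sigma * X w| ^+ 3 / 6) * r n)).
    move=> n; rewrite /f normrM (gtr0_norm (N0 n)).
    rewrite (le_trans (ler_wpM2l (ltW (N0 n)) (sin_taylor_bound3 _)))//.
    have -> : `|u n * X w| = `|t / sigma * X w| * r n.
      by rewrite uE mulrAC [LHS]normrM (ger0_norm (r_ge0 n)).
    rewrite (_ : N n * _ = N n * r n ^+ 2 * (`|t / sigma * X w| ^+ 3 / 6 * r n)); last by field.
    by rewrite r2 divff ?gt_eqF// mul1r.
  by rewrite -(mulr0 (`|t / sigma * X w| ^+ 3 / 6)); apply: cvgMr.
- move=> n w; rewrite /f normrM (gtr0_norm (N0 n)).
  rewrite (le_trans (ler_wpM2l (ltW (N0 n)) (sin_taylor_bound2 _)))//.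
  by rewrite -(Nu2 n) le_eqVlt; apply/orP; left; apply/eqP; ring.
- by move=> w; rewrite normr0 mulr_ge0 ?sqr_ge0// mulr_ge0 ?sqr_ge0.
Qed.

Lemma expansion_error_cvg0 : t != 0 ->
  (`|\int[P]_w cos (u n * X w) - expR (- v n)| + `|\int[P]_w sin (u n * X w)|) /
    (1 - expR (- v n)) @[n --> \oo] --> 0.
Proof.
move=> t0; have t20 : 0 < t ^+ 2 by rewrite exprn_even_gt0.
pose a n := \int[P]_w cos (u n * X w).
pose b n := \int[P]_w sin (u n * X w).
have v0 n : 0 < v n by rewrite divr_gt0// divr_gt0.
(* The prefactor reflects 1 - q >= v / 2 = t^2 / (4 N), valid once v <= 1; the middle term is N v^2
   / 2, the rescaled error of replacing q by 1 - v. *)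
pose g n := 4 / t ^+ 2 * (`|N n * (a n - (1 - v n))| + t ^+ 4 / 8 * (N n)^-1 + `|N n * b n|).
have g0 : g n @[n --> \oo] --> 0.
  rewrite -(mulr0 (4 / t ^+ 2)); apply: cvgMr.
  rewrite -[X in _ --> X](addr0 0); apply: cvgD.
    rewrite -[X in _ --> X](addr0 0); apply: cvgD.
      by apply/norm_cvg0P; exact: cos_expansion_cvg0.
    by rewrite -(mulr0 (t ^+ 4 / 8)); apply: cvgMr.
  by apply/norm_cvg0P; exact: sin_expansion_cvg0.
apply/norm_cvg0P; apply: (squeeze_cvgr _ (cvg_cst 0) g0); near=> n.
have v1 : v n <= 1.
  rewrite ler_pdivrMr// mul1r; near: n.
  apply: filterS (nbhs_infty_ger (t ^+ 2 / 2)) => n /le_trans; apply.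
  by rewrite ler_nat.
have := @one_sub_expRN_ge _ (v n); rewrite (ltW (v0 n)) v1 => /(_ isT) q1.
have q0 : 0 < 1 - expR (- v n) by rewrite (lt_le_trans _ q1)// divr_gt0.
rewrite normr_ge0/= ger0_norm; last by rewrite divr_ge0 ?(ltW q0)// addr_ge0.
rewrite ler_pdivrMr//.
have g_ge0 : 0 <= g n.
  apply: mulr_ge0; first by rewrite divr_ge0// ltW.
  apply: addr_ge0 => //; apply: addr_ge0 => //; apply: mulr_ge0.
    by rewrite divr_ge0// exprn_even_ge0.
  by rewrite invr_ge0 ltW.
apply: le_trans (ler_wpM2l g_ge0 q1).
rewrite (_ : g n * (v n / 2) =
    (`|N n * (a n - (1 - v n))| + t ^+ 4 / 8 * (N n)^-1 + `|N n * b n|) / N n); last first.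
  by rewrite /g /v -/(N n); field; rewrite t0 nat1r andbT pnatr_eq0.
rewrite !normrM (gtr0_norm (N0 n)) ler_pdivlMr// mulrDl.
rewrite (mulrC (N n) `|b n|) lerD// -/(a n).
rewrite (_ : t ^+ 4 / 8 * (N n)^-1 = N n * (v n ^+ 2 / 2)); last first.
  by rewrite /v -/(N n); field; rewrite gt_eqF.
rewrite -mulrDr mulrC ler_wpM2l ?(ltW (N0 n))//.
rewrite (_ : a n - expR (- v n) = (a n - (1 - v n)) - (expR (- v n) - (1 - v n))); last by ring.
by rewrite (le_trans (ler_normB _ _))// lerD2l expRN_taylor_bound// ltW.
Unshelve. all: by end_near. Qed.

End second_order_expansion.

(** * Random sums *)

Section random_sum_characteristic_function.
Context d (T : measurableType d) (R : realType) (P : probability T R)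
  (X : nat -> {RV P >-> R}) (iidX : iid X) (sigma : R) (sigma0 : 0 < sigma)
  (X_mean : ('E_P[X 0%N] = 0)%E) (X_var : ('V_P[X 0%N] = (sigma ^+ 2)%:E)%E)
  (Z : nat -> {RV P >-> nat})
  (indepZ : forall n : nat, (1 <= n)%N ->
     independent P (g_sigma_algebra_preimage (Z n)) (sigma_of_sequence X)).

(** The bound for partial sums does not depend on their length, so it survives averaging over the
    law of [Z n]. *)
Lemma random_sum_geometric_bound u q n : (1 <= n)%N -> 0 <= q < 1 ->
  let D := (`|\int[P]_w cos (u * X 0%N w) - q| + `|\int[P]_w sin (u * X 0%N w)|) /
           (1 - q) in
  `|\int[P]_w cos (u * random_sum X (Z n) w) - \int[P]_w (q ^+ Z n w)| <= D /\
  `|\int[P]_w sin (u * random_sum X (Z n) w)| <= D.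
Proof.
move=> n1 q01 D.
have [/ltW q0 /ltW q1] : -1 < q /\ q < 1 by case/andP: q01 => ? ?; split; lra.
have bound k := @partial_sum_geometric_bound _ _ _ P X iidX u q k q01.
have mnat (f : nat -> R) : measurable_fun setT (fun w => f (Z n w)).
  by apply: (@measurableT_comp _ _ _ _ _ _ f).
have le1 (h : R -> R) k : (forall x, `|h x| <= 1) -> bounded_measurable h ->
    `|\int[P]_w h (partial_sum X k w)| <= 1.
  move=> h1 bh; apply: norm_Rintegral_le1 => [|w]; last exact: h1.
  by apply: (bm_comp bh); exact: measurable_partial_sum.
have bcos := bm_cosM u; have bsin := bm_sinM u.
have bc : bounded_measurable (fun w => \int[P]_w' cos (u * partial_sum X (Z n w) w')).
  split; first exact: (mnat (fun k => \int[P]_w' cos (u * partial_sum X k w'))).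
  by exists 1 => w; apply: (le1 (fun x => cos (u * x))) => // x; exact: cos_max.
have bs : bounded_measurable (fun w => \int[P]_w' sin (u * partial_sum X (Z n w) w')).
  split; first exact: (mnat (fun k => \int[P]_w' sin (u * partial_sum X k w'))).
  by exists 1 => w; apply: (le1 (fun x => sin (u * x))) => // x; exact: sin_max.
have bq : bounded_measurable (fun w => q ^+ Z n w).
  split; first exact: (mnat (fun k => q ^+ k)).
  exists 1 => w; rewrite normrX exprn_ile1//.
  by rewrite ler_norml q0.
split.
- rewrite (random_sum_expectation (indepZ n1) bcos).
  rewrite -[leRHS](Rintegral_probability_cst P).
  apply: bm_norm_RintegralB => //; first exact: bmcst.
  by move=> w; have [] := bound (Z n w).
- rewrite (random_sum_expectation (indepZ n1) bsin).
  rewrite -[leRHS](Rintegral_probability_cst P) -[X in `|X|]subr0.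
  rewrite -[X in `|_ - X|](Rintegral_probability_cst P).
  apply: bm_norm_RintegralB => //; [exact: bmcst|exact: bmcst|].
  by move=> w; rewrite subr0; have [] := bound (Z n w).
Qed.

Let Y n w := random_sum X (Z n) w / (sigma * Num.sqrt n%:R).

Lemma random_sum_cos_sin_cvg (t : R) :
  (\int[P]_w cos (t * Y n w) -
     \int[P]_w expR (- (t ^+ 2 / 2) * ((Z n w)%:R / n%:R))) @[n --> \oo] --> 0 /\
  \int[P]_w sin (t * Y n w) @[n --> \oo] --> 0.
Proof.
(* At t = 0 one has q = 1 and the geometric bound is void, but all the integrands are constant. *)
have [->|t0] := eqVneq t 0.
  split.
  - under eq_fun => n.
      under eq_Rintegral do rewrite mul0r cos0.
      under [X in _ - X]eq_Rintegral do rewrite expr0n/= mul0r oppr0 mul0r expR0.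
      rewrite subrr; over.
    exact: cvg_cst.
  - under eq_fun => n.
      under eq_Rintegral do rewrite mul0r sin0.
      rewrite Rintegral_probability_cst; over.
    exact: cvg_cst.
pose u n := t / (sigma * Num.sqrt n.+1%:R).
pose v n : R := t ^+ 2 / 2 / n.+1%:R.
have := expansion_error_cvg0 sigma0 X_mean X_var t0.
have v0 n : 0 < v n by rewrite divr_gt0// divr_gt0// exprn_even_gt0.
have q01 n : 0 <= expR (- v n) < 1 by rewrite expR_ge0/= -expR0 ltr_expR oppr_lt0.
have YE n w : t * Y n.+1 w = u n * random_sum X (Z n.+1) w by rewrite /Y /u; ring.
have qE n w : expR (- (t ^+ 2 / 2) * ((Z n.+1 w)%:R / n.+1%:R)) = expR (- v n) ^+ Z n.+1 w.
  by rewrite -expRM_natl; congr expR; rewrite /v; ring.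
have bound n := random_sum_geometric_bound (u n) (isT : (1 <= n.+1)%N) (q01 n).
move=> D0; split; rewrite -cvg_shiftS; apply: cvg0_le_norm D0 => n.
- under eq_Rintegral do rewrite YE.
  under [X in _ - X]eq_Rintegral do rewrite qE.
  by have [] := bound n.
- under eq_Rintegral do rewrite YE.
  by have [] := bound n.
Qed.

End random_sum_characteristic_function.

(** * Transforms of the Linnik and Mittag-Leffler laws *)

Section limit_laws.
Context d (T : measurableType d) (R : realType) (P : probability T R).

Lemma linnik_cos_sin (alpha : R) (L : {RV P >-> R}) (t : R) :
  linnik alpha (distribution P L) ->
  \int[P]_w cos (t * L w) = 1 / (1 + `|t| `^ alpha) /\
  \int[P]_w sin (t * L w) = 0.
Proof.
move=> /(_ t); rewrite /characteristic_function => -[<- <-].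
have distr (f : R -> R) : bounded_measurable f ->
    \int[distribution P L]_x f x = \int[P]_w f (L w).
  move=> bf; rewrite /Rintegral integral_distribution//.
    by apply/measurable_EFinP; have [] := bf.
  by apply: bm_integrable; exact: bm_comp.
by split; rewrite distr//; [exact: bm_cosM|exact: bm_sinM].
Qed.

Lemma mittag_leffler_ae_ge0 (delta : R) (M : {RV P >-> R}) :
  mittag_leffler delta (distribution P M) -> {ae P, forall w, 0 <= M w}.
Proof.
move=> [M1 _]; have m0 : measurable [set x : R | 0 <= x].
  by rewrite -set_itvcy; exact: measurable_itv.
exists (~` (M @^-1` [set x | 0 <= x])); split.
- by apply: measurableC; exact: measurable_funPTI.
- rewrite probability_setC; last exact: measurable_funPTI.
  by rewrite [X in (1 - X)%E]M1 subee.
- by [].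
Qed.

Lemma mittag_leffler_laplace (delta : R) (M : {RV P >-> R}) (s : R) :
  0 <= s -> mittag_leffler delta (distribution P M) ->
  \int[P]_w expR (- s * `|M w|) = 1 / (1 + s `^ delta).
Proof.
move=> s0 hM; have M0 := mittag_leffler_ae_ge0 hM.
have [_ /(_ _ s0)] := hM; rewrite unlock ge0_integral_distribution//; last first.
  apply/measurable_EFinP; apply: continuous_measurable_fun => x.
  by apply: continuous_comp; [apply: cvgMr; exact: cvg_id|exact: continuous_expR].
move=> E; rewrite /Rintegral -[RHS]/(fine (1 / (1 + s `^ delta))%:E) -E; congr fine.
have mexp (V : T -> R) : measurable_fun setT V ->
    measurable_fun setT (fun w => (expR (- s * V w))%:E).
  move=> mV; apply/measurable_EFinP; apply: measurableT_comp => //.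
  by apply: measurable_funM => //; exact: measurable_cst.
apply: ae_eq_integral => //; [by apply: mexp; exact: measurableT_comp|exact: mexp|].
by apply: filterS M0 => w Mw _; rewrite /= ger0_norm.
Qed.

(** The limit variable is nonnegative only almost surely, while [laplace_continuity] asks for it at
    every point; the absolute value bridges the gap without changing the law. *)
Lemma cvg_in_distribution_norm d' (T' : measurableType d') (P' : probability T' R)
    (Y : nat -> T' -> R) (M : {RV P >-> R}) : {ae P, forall w, 0 <= M w} ->
  cvg_in_distribution P' P Y (fun w => 2 * M w) <->
  cvg_in_distribution P' P Y (fun w => 2 * `|M w|).
Proof.
move=> M0.
have E (f : R -> R) : continuous f ->
    ('E_P[f \o (fun w => 2 * M w)%R] = 'E_P[f \o (fun w => 2 * `|M w|)%R])%E.
  move=> cf; rewrite unlock; apply: ae_eq_integral => //.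
  - apply/measurable_EFinP; apply: measurableT_comp; first exact: continuous_measurable_fun.
    by apply: measurable_funM => //; exact: measurable_cst.
  - apply/measurable_EFinP; apply: measurableT_comp; first exact: continuous_measurable_fun.
    by apply: measurable_funM; [exact: measurable_cst|exact: measurableT_comp].
  - by apply: filterS M0 => w Mw _; rewrite /= ger0_norm.
by split=> YM f cf bf; [rewrite -E//|rewrite E//]; exact: YM.
Qed.

End limit_laws.

Theorem theorem4 (R : realType) (alpha : R) (halpha : 0 < alpha <= 2)
  (d : measure_display) (T : measurableType d) (P : probability T R)
  (X : nat -> {RV P >-> R}) (hX : iid X)
  (sigma : R) (hsigma : 0 < sigma)
  (hmean : ('E_P[X 0%N] = 0)%E) (hvar : ('V_P[X 0%N] = (sigma ^+ 2)%:E)%E)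
  (Z : nat -> {RV P >-> nat})
  (hindep : forall n : nat, (1 <= n)%N ->
     independent P (g_sigma_algebra_preimage (Z n)) (sigma_of_sequence X))
  (hZ : forall m : R, 0 < m ->
     P [set w | (Z n w)%:R <= m] @[n --> \oo] --> 0%E)
  (d1 : measure_display) (T1 : measurableType d1) (P1 : probability T1 R)
  (L : {RV P1 >-> R}) (hL : linnik alpha (distribution P1 L))
  (d2 : measure_display) (T2 : measurableType d2) (P2 : probability T2 R)
  (M : {RV P2 >-> R}) (hM : mittag_leffler (alpha / 2) (distribution P2 M)) :
  cvg_in_distribution P P1
    (fun n w => random_sum X (Z n) w / (sigma * Num.sqrt n%:R)) L
  <->
  cvg_in_distribution P P2
    (fun n w => (Z n w)%:R / n%:R) (fun w => 2 * M w).
Proof.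
rewrite (cvg_in_distribution_norm _ _ (mittag_leffler_ae_ge0 hM)).
pose Y n w := random_sum X (Z n) w / (sigma * Num.sqrt n%:R).
pose W n w : R := (Z n w)%:R / n%:R.
pose V w : R := 2 * `|M w|.
have mY n : measurable_fun setT (Y n).
  by apply: measurable_funM; [exact: measurable_random_sum|exact: measurable_cst].
have mW n : measurable_fun setT (W n).
  apply: measurable_funM; last exact: measurable_cst.
  exact: (@measurableT_comp _ _ _ _ _ _ (fun k : nat => k%:R : R)).
have mV : measurable_fun setT V.
  by apply: measurable_funM; [exact: measurable_cst|exact: measurableT_comp].
have mL : measurable_fun setT L by exact: measurable_funP.
have W0 n w : 0 <= W n w by rewrite divr_ge0.
have V0 w : 0 <= V w by rewrite mulr_ge0.
have YW t := random_sum_cos_sin_cvg hX hsigma hmean hvar hindep t.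
have laplaceV s : 0 <= s ->
    \int[P2]_w expR (- s * V w) = 1 / (1 + (2 * s) `^ (alpha / 2)).
  move=> s0; rewrite -(mittag_leffler_laplace _ hM) ?mulr_ge0//.
  by apply: eq_Rintegral => w _; congr expR; rewrite /V; ring.
(* The identity between the two limit transforms, which links the two convergences. *)
have cosL t : \int[P1]_w cos (t * L w) = \int[P2]_w expR (- (t ^+ 2 / 2) * V w).
  rewrite laplaceV ?divr_ge0 ?sqr_ge0// (linnik_cos_sin t hL).1.
  rewrite (_ : 2 * (t ^+ 2 / 2) = `|t| ^+ 2); last by rewrite real_normK ?num_real//; field.
  rewrite -powR_mulrn// -powRrM (_ : 2%:R * (alpha / 2) = alpha)//; by field.
split=> [/(cvg_in_distributionP P P1 mY mL) YL|/(cvg_in_distributionP P P2 mW mV) WV].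
- apply: laplace_continuity => // s s0.
  (* Every Laplace argument s >= 0 is t^2 / 2 for this frequency. *)
  pose t := Num.sqrt (2 * s).
  have ts : t ^+ 2 / 2 = s by rewrite sqr_sqrtr ?mulr_ge0//; field.
  have [_ cvgL] : converges_on P P1 Y L (fun x => cos (t * x)).
    apply: YL => [x|]; last by apply/bounded_funP; exists 1 => x; exact: cos_max.
    by apply: continuous_comp; [apply: cvgMr; exact: cvg_id|exact: continuous_cos].
  have : \int[P]_w cos (t * Y n w) - (\int[P]_w cos (t * Y n w) -
      \int[P]_w expR (- (t ^+ 2 / 2) * W n w)) @[n --> \oo] -->
      \int[P1]_w cos (t * L w) - 0.
    by apply: cvgB; [exact: cvgL|exact: (YW t).1].
  rewrite subr0 cosL ts; apply: cvg_trans; apply: near_eq_cvg; apply: nearW => n /=.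
  by rewrite opprB addrC subrK.
- apply: levy_continuity => // t.
  (* The absolute value makes the exponential bounded on the whole line, hence an admissible test
     function; it changes nothing on the nonnegative [W] and [V]. *)
  + have [_ cvgV] : converges_on P P2 W V (fun x => expR (- (t ^+ 2 / 2) * `|x|)).
      apply: WV => [x|].
        apply: continuous_comp; last exact: continuous_expR.
        by apply: cvgMr; exact: norm_continuous.
      apply/bounded_funP; exists 1 => x; rewrite ger0_norm ?expR_ge0//.
      by rewrite -expR0 ler_expR mulNr oppr_le0 mulr_ge0// divr_ge0 ?sqr_ge0.
    have absV : \int[P2]_w expR (- (t ^+ 2 / 2) * `|V w|) =
        \int[P2]_w expR (- (t ^+ 2 / 2) * V w).
      by apply: eq_Rintegral => w _; rewrite ger0_norm.
    have absW n : \int[P]_w expR (- (t ^+ 2 / 2) * `|W n w|) =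
        \int[P]_w expR (- (t ^+ 2 / 2) * W n w).
      by apply: eq_Rintegral => w _; rewrite ger0_norm.
    have : (\int[P]_w cos (t * Y n w) -
        \int[P]_w expR (- (t ^+ 2 / 2) * W n w)) +
        \int[P]_w expR (- (t ^+ 2 / 2) * `|W n w|) @[n --> \oo] -->
        0 + \int[P2]_w expR (- (t ^+ 2 / 2) * `|V w|).
      by apply: cvgD; [exact: (YW t).1|exact: cvgV].
    rewrite add0r absV -cosL; apply: cvg_trans; apply: near_eq_cvg.
    by apply: nearW => n; rewrite absW subrK.
  + by rewrite (linnik_cos_sin t hL).2; exact: (YW t).2.
Qed.
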